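(* Let $p$ be a prime, $0<\alpha\le1$, $\beta=\alpha^3-\epsilon$ with $\epsilon>0$, and suppose $\beta\ge\alpha^{C_p}/2$. Then there is an absolute constant $K$ such that: (1) $n_p(\alpha,\beta)\le \mathrm{Tow}\big(p,\log((\alpha-\alpha^3)/\epsilon)+5,1/\epsilon\big)$; (2) if $2^{-8-8C_p}\alpha^3<\beta\le 2^{-8-8C_p}\alpha$, then $n_p(\alpha,\beta)\le \mathrm{Tow}\big(p,\log(\beta/\epsilon)+K(\log p)\log\log_p(\alpha/\beta),1/\epsilon\big)$; (3) if $\beta\le 2^{-8-8C_p}\alpha^3$, then $n_p(\alpha,\beta)\le\mathrm{Tow}\big(p,K(\log p)\log\frac{\log(\alpha/\beta)}{\log(\alpha^3/\beta)},1/\beta\big)$.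
   Context: For a prime $p$, $A\subseteq\mathbb{F}_p^n$ has density $|A|/p^n$; the density of 3-APs in $A$ with common difference $d$ is $p^{-n}|\{x: x,x+d,x+2d\in A\}|$. For $0<\alpha\le1$, $\beta<\alpha^3$, $n_p(\alpha,\beta)$ is the least positive integer $N$ such that for all $n\ge N$ and all $A\subseteq\mathbb{F}_p^n$ of density at least $\alpha$ some nonzero $d$ has 3-AP density at least $\beta$. $\mathrm{Tow}(a,0,r)=r$, $\mathrm{Tow}(a,k+1,r)=a^{\mathrm{Tow}(a,k,r)}$, heights rounded up to integers. Logarithms base 2. $C_p\ge1$ is a constant depending only on $p$ (with $C_p=\Theta(\log p)$) such that for every $m\ge1$ and every $X\subseteq\mathbb{F}_p^m$ with $|X|=xp^m$, the number of pairs $(a,d)\in(\mathbb{F}_p^m)^2$ with $a,a+d,a+2d\in X$ is at least $x^{C_p}p^{2m}$. *)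

(* Defs.v *)
From mathcomp Require Import all_boot all_order all_algebra.
From Stdlib Require Import Reals.
Set Implicit Arguments. Unset Strict Implicit. Unset Printing Implicit Defensive.
Import GRing.Theory.

Section APSets.
Local Open Scope ring_scope.
Definition ap_set (p n : nat) (A : {set 'rV['F_p]_n}) (d : 'rV['F_p]_n) : {set 'rV['F_p]_n} :=
  [set x : 'rV['F_p]_n | [&& x \in A, x + d \in A & x + d *+ 2 \in A]].
Definition ap_pair_set (p m : nat) (X : {set 'rV['F_p]_m}) : {set 'rV['F_p]_m * 'rV['F_p]_m} :=
  [set ad : 'rV['F_p]_m * 'rV['F_p]_m |
       [&& ad.1 \in X, ad.1 + ad.2 \in X & ad.1 + ad.2 *+ 2 \in X]].
Definition nonzero_vec (p n : nat) (d : 'rV['F_p]_n) : bool := d != 0.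
End APSets.

Local Open Scope R_scope.

Definition log2 (x : R) : R := ln x / ln 2.

Definition rpow (x c : R) : R := if Rle_dec x 0 then 0 else Rpower x c.

(* ceiling of a real number as a natural number (negative values give 0) *)
Definition ceilR (x : R) : nat := Z.to_nat (- (up (- x) - 1))%Z.

Fixpoint tow (a : R) (k : nat) (r : R) : R :=
  match k with
  | O => r
  | S k' => Rpower a (tow a k' r)
  end.

Definition Tow (a h r : R) : R := tow a (ceilR h) r.

Definition density (p n : nat) (A : {set 'rV['F_p]_n}) : R :=
  INR #|A| / INR (expn p n).

Definition ap_density (p n : nat) (A : {set 'rV['F_p]_n}) (d : 'rV['F_p]_n) : R :=
  INR #|ap_set A d|
  / INR (expn p n).

Definition ap_pairs (p m : nat) (X : {set 'rV['F_p]_m}) : nat :=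
  #|ap_pair_set X|.

Definition np_good (p : nat) (alpha beta : R) (N : nat) : Prop :=
  forall n : nat, leq N n ->
  forall A : {set 'rV['F_p]_n}, alpha <= density A ->
  exists d : 'rV['F_p]_n, nonzero_vec d /\ beta <= ap_density A d.

(* n_p(alpha,beta) <= T : the least positive N with np_good exists and is <= T;
   since np_good is upward closed this is equivalent to the existence of
   some positive N <= T with np_good N. *)
Definition np_le (p : nat) (alpha beta T : R) : Prop :=
  exists N : nat, leq 1 N /\ INR N <= T /\ np_good p alpha beta N.

Definition supersat (p : nat) (Cp : R) : Prop :=
  forall (m : nat) (X : {set 'rV['F_p]_m}), leq 1 m ->
    rpow (density X) Cp * INR (expn p (2 * m)%nat) <= INR (ap_pairs X).

(* Main.v *)
(**
For a subspace H let b(H) be the mean over x of the cube of the density of A on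
x + H.  If no nonzero difference is popular, pass from H to the subspace H' of H
annihilated by all characters of H at which A has a large Fourier coefficient on
some coset of H.  This costs one exponential in the codimension and makes the
3-AP density of A within the cosets of H close to that of the average of A over
H', so the latter is at most about beta.  Schur's inequality for that average then
gives b(H') >= 2 b(H) - beta, while supersaturation applied to its level set at
half the mean gives b(H') >= mu^2 (b(H) - 8 (4 mu)^C beta) for every mu > 0.  The
excess b - beta therefore doubles at each step, and once b / beta = 2^u with
u >= 5 C + 10 the exponent u grows by a factor 1 + 1/C at each step.  Since b is at
most the density of A, the number of steps, that is the height of the tower, is
bounded.  For p = 2 a progression is just a pair, and counting pairs suffices.
*)
From Stdlib Require Import ZArith Reals Lra Psatz Classical.
From mathcomp Require Import all_boot all_order all_algebra all_fingroup.
From mathcomp Require Import zify complex Rstruct.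
From mathcomp Require ring lra.
Require Import Defs.
Set Implicit Arguments. Unset Strict Implicit. Unset Printing Implicit Defensive.
Import Order.TTheory GRing.Theory Num.Theory.

Local Open Scope R_scope.

(** The base [p] of the tower comes from Parseval: in codimension [k] there are [p^k] cosets, each
    with at most [delta^-2] coefficients above [delta], and a single H' has to serve all of them.
    The difference 0 is not covered by the assumption of unpopularity, so every H must stay large
    enough for its share [p^-(dim H)] to be at most [delta]; this ties the number of steps to [n].
    The two losses turn [beta] into [beta + 2 delta], where [delta] is a fraction of [eps] or
    [beta], and the bottom [2 / delta^2] of the tower is traded for a few extra levels. The three
    ranges differ in where the growth starts. An excess of order [eps] is always there, and doubling
    alone carries it past [alpha], which gives (1). In (3) the exponent [u = log (alpha^3 / beta)]
    is at least [8 C + 8 >= 5 C + 10] from the outset, so only the faster growth is used. In (2)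
    doubling produces such an exponent and the faster growth finishes. *)

(** * Towers of exponentials and the two growth recursions *)

Lemma ln_le x y : 0 < x -> x <= y -> ln x <= ln y.
Proof.
by move=> x0 [xy|->]; [apply/Rlt_le/ln_increasing | apply: Rle_refl].
Qed.

Lemma ln_ge_1 a : 3 <= a -> 1 <= ln a.
Proof.
move=> a3; rewrite -(ln_exp 1); have := exp_le_3; have := exp_pos 1 => e0 e3.
by apply: ln_le => //; lra.
Qed.

Lemma ln_ge_half a : 2 <= a -> / 2 <= ln a.
Proof.
move=> a2; apply: Rle_trans (_ : ln 2 <= _); last by apply: ln_le; lra.
by have := ln_lt_2; lra.
Qed.

Lemma Rpower_ge_id a x : 2 <= a -> 0 <= x -> x <= Rpower a x.
Proof.
move=> a2 x0; have la := ln_ge_half a2; rewrite /Rpower.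
have -> : x * ln a = (x * ln a - 1) + 1 by ring.
rewrite exp_plus; have := exp_ineq1_le (x * ln a - 1); have := exp_ineq1_le 1.
move: (exp _) (exp 1) => u e h1 h2.
have xl : x <= 2 * (x * ln a) by nra.
have : 2 * u <= u * e by nra.
lra.
Qed.

Lemma Rpower_ge_3x a x : 3 <= a -> 1 <= x -> 3 * x <= Rpower a x.
Proof.
move=> a3 x1; have la := ln_ge_1 a3.
have -> : x = 1 + (x - 1) by ring.
rewrite Rpower_plus Rpower_1; last by lra.
have : x <= Rpower a (x - 1).
  rewrite /Rpower; have := exp_ineq1_le ((x - 1) * ln a); nra.
move: (Rpower _ _) => u; nra.
Qed.

Lemma tow_ge0 a k r : 0 <= r -> 0 <= tow a k r.
Proof. by case: k => // k _; apply/Rlt_le/exp_pos. Qed.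

Lemma tow_le_S a k r : 2 <= a -> 0 <= r -> tow a k r <= tow a k.+1 r.
Proof. by move=> a2 r0; apply: Rpower_ge_id => //; apply: tow_ge0. Qed.

Lemma tow_le_height a k l r : 2 <= a -> 0 <= r -> (k <= l)%N ->
  tow a k r <= tow a l r.
Proof.
move=> a2 r0 /subnK<-; elim: (l - k)%N => [|j IH]; first exact: Rle_refl.
by apply: Rle_trans IH _; apply: tow_le_S.
Qed.

Lemma tow_le_top a k r s : 2 <= a -> r <= s -> tow a k r <= tow a k s.
Proof.
move=> a2 rs; elim: k => //= k IH; apply: Rle_Rpower => //; lra.
Qed.

Lemma tow_addn a k l r : tow a (k + l) r = tow a k (tow a l r).
Proof. by elim: k => //= k ->. Qed.

(** Two levels already give [a^(3 r) = (a^r)^3 >= 27 r^3], and every further level gains a factor 3.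
    This is how a quadratic loss at the bottom of a tower is paid for by height. *)
Lemma tow_ge_sqr a c r : 3 <= a -> 1 <= r ->
  3 ^ c * (27 * r ^ 2) <= tow a (c + 2) r.
Proof.
move=> a3 r1; elim: c => [|c IH].
  rewrite /= Rmult_1_l; set y := Rpower a r.
  have y3 : 3 * r <= y by apply: Rpower_ge_3x.
  apply: Rle_trans (_ : Rpower a (r + r + r) <= _); last by apply: Rle_Rpower; lra.
  rewrite !Rpower_plus -/y.
  have : (3 * r) * (3 * r) * (3 * r) <= y * y * y.
    by apply: Rmult_le_compat; [nra|nra|apply: Rmult_le_compat; nra|].
  nra.
rewrite addSn /=; set t := tow _ _ _ in IH *.
have c1 : 1 <= 3 ^ c by apply: pow_R1_Rle; lra.
have r2 : 1 <= r ^ 2 by apply: pow_R1_Rle.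
have t1 : 1 <= t by nra.
by have := Rpower_ge_3x a3 t1; nra.
Qed.

(* The slack [2 * Q] absorbs both the additive and the multiplicative losses. *)
Lemma tow_step a k Q T : 3 <= a -> 0 <= k -> 1 <= Q -> k + 2 * Q <= T ->
  k + Q * Rpower a k + 2 * Q <= Rpower a T.
Proof.
move=> a3 k0 Q1 kT; apply: Rle_trans (Rle_Rpower a _ _ _ kT); last by lra.
rewrite Rpower_plus; have kk : k <= Rpower a k by apply: Rpower_ge_id; lra.
have k1 : 1 <= Rpower a k.
  by rewrite -(Rpower_O a); last lra; apply: Rle_Rpower; lra.
have := @Rpower_ge_3x a (2 * Q) a3; move: (Rpower a k) (Rpower _ _) kk k1 => u v; nra.
Qed.

Lemma doubling_sequence (b : nat -> R) B j :
  (forall i, (i < j)%N -> 2 * b i - B <= b i.+1) ->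
  2 ^ j * (b 0%N - B) <= b j - B.
Proof.
elim: j => [|j IH] h /=; first lra.
have := h j (leqnn _); have := IH (fun i ij => h i (ltnW ij)); lra.
Qed.

(** Take [mu] with [(4 mu)^C = 2^(u - 5)]: the subtracted term is then at most half of [beta 2^u],
    hence of [b], and [b' >= mu^2 beta 2^u / 2]. The exponent obtained is
    [u + 2 ((u - 5) / C - 2) - 1], which is at least [u (1 + 1 / C)] exactly when
    [u >= 5 C + 10]. *)
Lemma supersat_growth beta C B u b b' :
  0 < beta -> 1 <= C -> B <= 2 * beta -> 5 * C + 10 <= u ->
  beta * Rpower 2 u <= b ->
  (forall mu, 0 < mu -> mu ^ 2 * (b - 8 * Rpower (4 * mu) C * B) <= b') ->
  beta * Rpower 2 (u * (1 + / C)) <= b'.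
Proof.
move=> b0 C1 B2 u8 ub /(_ (Rpower 2 ((u - 5) / C - 2)) (exp_pos _)).
apply: Rle_trans; set mu := Rpower 2 (_ - _).
have E4 : 4 * mu = Rpower 2 ((u - 5) / C).
  have -> : (u - 5) / C = 2 + ((u - 5) / C - 2) by ring.
  rewrite Rpower_plus -/mu; congr (_ * _).
  by rewrite (_ : 2 = INR 2) ?Rpower_pow /=; lra.
have -> : Rpower (4 * mu) C = Rpower 2 (u - 5).
  by rewrite E4 Rpower_mult; congr Rpower; field; lra.
have E5 : Rpower 2 u = 32 * Rpower 2 (u - 5).
  have {1}-> : u = 5 + (u - 5) by ring.
  rewrite Rpower_plus; congr (_ * _).
  by rewrite (_ : 5 = INR 5) ?Rpower_pow /=; lra.
have v0 : 0 < Rpower 2 (u - 5) by exact: exp_pos.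
have mu0 : 0 < mu by exact: exp_pos.
apply: (@Rle_trans _ (mu ^ 2 * (beta * Rpower 2 u / 2))); last first.
  by apply: Rmult_le_compat_l; [nra | nra].
have -> : mu ^ 2 * (beta * Rpower 2 u / 2) =
    beta * Rpower 2 (u + 2 * ((u - 5) / C - 2) - 1).
  have -> : u + 2 * ((u - 5) / C - 2) - 1 =
    u + ((u - 5) / C - 2) + ((u - 5) / C - 2) + Ropp 1 by ring.
  rewrite 3!Rpower_plus -/mu (Rpower_Ropp 2 1) Rpower_1; last lra.
  by field.
apply: Rmult_le_compat_l; first lra.
apply: Rle_Rpower; first lra.
suff : 0 <= (u - 5 * C - 10) / C.
  have -> : (u - 5 * C - 10) / C = u + 2 * ((u - 5) / C - 2) - 1 - u * (1 + / C).
    by field; lra.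
  lra.
apply: Rmult_le_pos; first lra.
by apply/Rlt_le/Rinv_0_lt_compat; lra.
Qed.

Lemma supersat_sequence (b : nat -> R) beta C B u j0 j :
  0 < beta -> 1 <= C -> B <= 2 * beta -> 5 * C + 10 <= u ->
  (forall i, (j0 <= i < j0 + j)%N ->
     forall mu, 0 < mu -> mu ^ 2 * (b i - 8 * Rpower (4 * mu) C * B) <= b i.+1) ->
  beta * Rpower 2 u <= b j0 ->
  beta * Rpower 2 (u * (1 + / C) ^ j) <= b (j0 + j)%N.
Proof.
move=> b0 C1 B2 u8 h ub0; elim: j h => [|j IH] h; first by rewrite addn0 Rmult_1_r.
have iC : 0 < / C by apply: Rinv_0_lt_compat; lra.
have P1 : 1 <= (1 + / C) ^ j by apply: pow_R1_Rle; lra.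
rewrite addnS; have -> : u * (1 + / C) ^ j.+1 = u * (1 + / C) ^ j * (1 + / C).
  by rewrite /=; ring.
apply: supersat_growth => //.
- by exact: B2.
- nra.
- apply: IH => i /andP[i1 i2]; apply: h; rewrite i1 /=.
  by rewrite addnS (leq_trans i2).
by apply: h; rewrite leq_addr addnS ltnSn.
Qed.

(** With [y = 1 / (2 C) <= 1 / 2] one has [exp y <= 1 / (1 - y) <= 1 + 2 y]. *)
Lemma exp_le_pow C j : 1 <= C -> exp (INR j / (2 * C)) <= (1 + / C) ^ j.
Proof.
move=> C1; set y := / (2 * C).
have y0 : 0 < y by apply: Rinv_0_lt_compat; lra.
have y2 : y <= / 2 by apply: Rinv_le_contravar; lra.
have -> : / C = 2 * y by rewrite /y; field; lra.
have e1 : exp y <= 1 + 2 * y.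
  have := exp_ineq1_le (- y); rewrite exp_Ropp => h.
  have e0 := exp_pos y; have : (1 - y) * exp y <= 1.
    have {2}<- : / exp y * exp y = 1 by field; lra.
    by apply: Rmult_le_compat_r; lra.
  nra.
have -> : INR j / (2 * C) = y * INR j by rewrite /y; field; lra.
have -> : exp (y * INR j) = exp y ^ j.
  by rewrite -Rpower_pow; [rewrite /Rpower ln_exp Rmult_comm | exact: exp_pos].
by apply: pow_incr; split=> //; apply/Rlt_le/exp_pos.
Qed.

Lemma INR_expn a k : INR (expn a k) = INR a ^ k.
Proof. by elim: k => //= k IH; rewrite expnS mult_INR IH. Qed.

(** Induction, using [(1 + 1 / m)^m <= e <= 3]. *)
Lemma fact_lower m : INR m ^ m <= 3 ^ m * INR m`!.
Proof.
elim: m => [|m IH]; first by rewrite /=; lra.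
have m0 : 0 <= INR m by apply: pos_INR.
have h : INR m.+1 ^ m <= 3 * INR m ^ m.
  case: m m0 {IH} => [|m] m0; first by rewrite /=; lra.
  have m1 : 0 < INR m.+1 by apply: lt_0_INR; apply/ssrnat.ltP.
  have e : INR m.+2 <= INR m.+1 * exp (/ INR m.+1).
    rewrite (S_INR m.+1); have := exp_ineq1_le (/ INR m.+1) => h.
    have : INR m.+1 * (1 + / INR m.+1) <= INR m.+1 * exp (/ INR m.+1).
      by apply: Rmult_le_compat_l; lra.
    by rewrite Rmult_plus_distr_l Rinv_r; lra.
  have := pow_incr _ _ m.+1 (conj (pos_INR m.+2) e).
  rewrite Rpow_mult_distr -(Rpower_pow m.+1 (exp _)); last exact: exp_pos.
  rewrite /Rpower ln_exp Rinv_r; last lra.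
  have := exp_le_3; have := pow_lt _ m.+1 m1; nra.
rewrite factS mult_INR; change (INR m.+1 * INR m.+1 ^ m <= 3 * 3 ^ m * (INR m.+1 * INR m`!)).
have : INR m.+1 * INR m.+1 ^ m <= INR m.+1 * (3 * (3 ^ m * INR m`!)).
  by apply: Rmult_le_compat_l; [apply: pos_INR | lra].
lra.
Qed.

(** * A progression-free set that bounds the supersaturation exponent from below *)

Section PermutationSet.
Variables (p m : nat).
Hypotheses (p_pr : prime p) (pE : p = (2 * m).-1) (m_gt0 : (0 < m)%N).

(** All entries are below [m = (p + 1) / 2], so sums of two entries do not wrap around modulo [p]
    and progressions can be studied over the integers. *)
Definition perm_vec (s : 'S_m) : 'rV['F_p]_m := (\row_i (s i)%:R)%R.

Definition perm_vecs : {set 'rV['F_p]_m} := [set perm_vec s | s : 'S_m].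

Lemma natr_Fp_inj (a b : nat) :
  (a < p)%N -> (b < p)%N -> (a%:R = b%:R :> 'F_p)%R -> a = b.
Proof.
move=> ap bp /(congr1 (@nat_of_ord _)).
by rewrite !(val_Fp_nat p_pr) !modn_small.
Qed.

Lemma perm_lt_p (s : 'S_m) i : (s i < p)%N.
Proof. by have := ltn_ord (s i); lia. Qed.

Lemma perm_vec_inj : injective perm_vec.
Proof.
move=> s t /rowP st; apply/permP => i; apply/val_inj.
by have := st i; rewrite !mxE; apply: natr_Fp_inj; apply: perm_lt_p.
Qed.

Lemma sum_perm_sqr (s : 'S_m) : (\sum_i s i ^ 2 = \sum_(i < m) i ^ 2)%N.
Proof. by rewrite [RHS](reindex_inj (@perm_inj _ s)). Qed.

(* The vectors lie on a common sphere, which contains no proper progression. *)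
Lemma perm_vecs_ap_free a d :
  a \in perm_vecs -> (a + d)%R \in perm_vecs -> (a + d *+ 2)%R \in perm_vecs -> d = 0%R.
Proof.
case/imsetP=> s0 _ aE /imsetP[s1 _ bE] /imsetP[s2 _ cE].
have sE i : (s0 i + s2 i = 2 * s1 i)%N.
  apply: natr_Fp_inj.
  - by have := ltn_ord (s0 i); have := ltn_ord (s2 i); lia.
  - by have := ltn_ord (s1 i); lia.
  have : (a + (a + d *+ 2) = (a + d) *+ 2)%R by rewrite mulrnDl mulr2n addrA.
  rewrite cE bE aE => /rowP/(_ i); rewrite !mxE => h.
  by rewrite natrD h natrM mulr_natl.
have : (\sum_i (s0 i ^ 2 + s2 i ^ 2) = \sum_i 2 * (s0 i * s2 i))%N.
  have : (\sum_i (s0 i + s2 i) ^ 2 = 4 * \sum_i s1 i ^ 2)%N.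
    by rewrite big_distrr /=; apply: eq_bigr => i _; rewrite sE expnMn.
  under eq_bigr do rewrite sqrnD.
  rewrite !big_split /= !sum_perm_sqr; lia.
move/esym/eqP.
have /leqif_sum h : forall i : 'I_m, true ->
    (2 * (s0 i * s2 i) <= s0 i ^ 2 + s2 i ^ 2 ?= iff (s0 i == s2 i :> nat))%N.
  by move=> i _; apply: nat_Cauchy.
rewrite h => /forall_inP eq02.
have : perm_vec s0 = perm_vec s1.
  apply/rowP => i; rewrite !mxE; congr (_%:R)%R.
  by have := eqP (eq02 i isT); have := sE i; lia.
by rewrite -aE -bE -{1}[a]addr0 => /addrI->.
Qed.

Lemma card_perm_vecs : #|perm_vecs| = m`!.
Proof. by rewrite card_imset ?cardsT ?card_Sn //; apply: perm_vec_inj. Qed.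

Lemma ap_pairs_perm_vecs : (ap_pairs perm_vecs <= m`!)%N.
Proof.
rewrite -card_perm_vecs /ap_pairs.
rewrite -(card_imset (mem perm_vecs) (_ : injective (fun a => (a, 0%R : 'rV['F_p]_m)))).
  apply/subset_leq_card/subsetP => -[a d]; rewrite inE /= => /and3P[ha hb hc].
  rewrite (perm_vecs_ap_free ha hb hc); apply/imsetP; by exists a.
by move=> a b [].
Qed.

End PermutationSet.

(* Ensures that [ln (alpha / beta) / ln p >= 2] in the range of part (2), so that
   its iterated logarithm is bounded below. *)
Lemma supersat_exponent_ge p C : prime p -> (2 < p)%N -> 1 <= C -> supersat p C ->
  log2 (INR p) <= 3 * (C - 1).
Proof.
move=> p_pr p2 C1 sup.
have [m [m0 pE]] : exists m, (0 < m)%N /\ p = (2 * m).-1.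
  exists p./2.+1; split=> //; have := odd_double_half p; have := even_prime p_pr.
  by case: (odd p) => -[|] //; lia.
have := @sup m (perm_vecs p m) m0.
have := ap_pairs_perm_vecs p_pr pE m0 => /ssrnat.leP/le_INR apm.
move/Rle_trans => /(_ _ apm).
have pR : 0 < INR p by apply: lt_0_INR; apply/ssrnat.ltP/prime_gt0.
have f0 : 0 < INR m`! by apply: lt_0_INR; apply/ssrnat.ltP; rewrite fact_gt0.
rewrite /density card_perm_vecs // !INR_expn.
set x := INR m`! / _; have xE : x = INR m`! / INR p ^ m by [].
clearbody x.
have x0 : 0 < x by rewrite xE; apply: Rdiv_lt_0_compat => //; apply: pow_lt.
rewrite /rpow; case: Rle_dec => h; first lra.
have mE : INR m`! = x * INR p ^ m by rewrite xE; field; apply: pow_nonzero; lra.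
rewrite mE mul2n -addnn pow_add => sup1.
have mR : 0 < INR m by apply: lt_0_INR; apply/ssrnat.ltP.
have lnX a k : 0 < a -> ln (a ^ k) = INR k * ln a.
  by move=> a0; rewrite -Rpower_pow // /Rpower ln_exp.
have pm0 : 0 < INR p ^ m by apply: pow_lt.
have l1 : (C - 1) * ln x + INR m * ln (INR p) <= 0.
  have pp : 0 < INR p ^ m * INR p ^ m by apply: Rmult_lt_0_compat.
  have r0 : 0 < Rpower x C by exact: exp_pos.
  have := ln_le (Rmult_lt_0_compat _ _ r0 pp) sup1.
  rewrite !ln_mult // lnX // {1}/Rpower ln_exp; lra.
(* Since [p <= 2 m] and [m! >= (m / 3)^m], the density [x] is at least [6^-m]. The dimension then
   cancels from [l1], leaving [ln p <= (C - 1) ln 6]. *)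
have l2 : - (INR m * ln 6) <= ln x.
  have pm : INR p ^ m <= (2 * INR m) ^ m.
    apply: pow_incr; split; first lra.
    rewrite -(mult_INR 2); apply: le_INR; apply/ssrnat.leP; lia.
  have h6 : INR p ^ m <= INR m`! * 6 ^ m.
    apply: Rle_trans pm _; rewrite (_ : 6 = 2 * 3) ?Rpow_mult_distr; last lra.
    have := fact_lower m; have := pow_lt 2 m Rlt_0_2; nra.
  have p6 : 0 < 6 ^ m by apply: pow_lt; lra.
  have xp : 0 < x * INR p ^ m by apply: Rmult_lt_0_compat.
  have six : 0 < 6 by lra.
  have := ln_le pm0 h6; rewrite mE (ln_mult _ _ xp p6) (ln_mult _ _ x0 pm0).
  rewrite !lnX //; lra.
have l6 : ln 6 <= 3 * ln 2.
  have <- : ln (2 ^ 3) = 3 * ln 2 by rewrite lnX /=; lra.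
  by apply: ln_le; lra.
have l20 : / 2 < ln 2 by exact: ln_lt_2.
have lp : ln (INR p) <= (C - 1) * ln 6.
  apply: (Rmult_le_reg_l (INR m)) => //.
  have : (C - 1) * (- (INR m * ln 6)) <= (C - 1) * ln x by apply: Rmult_le_compat_l; lra.
  lra.
apply: (Rmult_le_reg_r (ln 2)); first lra.
rewrite /log2 /Rdiv Rmult_assoc Rinv_l ?Rmult_1_r; last lra.
have : (C - 1) * ln 6 <= (C - 1) * (3 * ln 2) by apply: Rmult_le_compat_l; lra.
lra.
Qed.

Local Open Scope ring_scope.

(** * Normalised averages over finite types *)

Section Average.
Variables (F : numFieldType).
Implicit Types (T U : finType).

(** A general [numFieldType] lets the same average serve real densities and complex Fourier
    coefficients. *)
Definition avg T (g : T -> F) : F := #|T|%:R^-1 * \sum_t g t.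

Lemma eq_avg T (f g : T -> F) : f =1 g -> avg f = avg g.
Proof. by move=> fg; rewrite /avg (eq_bigr _ (fun t _ => fg t)). Qed.

Lemma avgD T (f g : T -> F) : avg (fun t => f t + g t) = avg f + avg g.
Proof. by rewrite /avg big_split mulrDr. Qed.

Lemma avgZ T (c : F) (f : T -> F) : avg (fun t => c * f t) = c * avg f.
Proof. by rewrite /avg -mulr_sumr mulrCA. Qed.

Lemma avgZr T (c : F) (f : T -> F) : avg (fun t => f t * c) = avg f * c.
Proof. by rewrite mulrC -avgZ; apply: eq_avg => t; rewrite mulrC. Qed.

Lemma avgB T (f g : T -> F) : avg (fun t => f t - g t) = avg f - avg g.
Proof. by rewrite /avg big_split sumrN mulrBr. Qed.

Lemma avg_mul3 T (g h k : T -> F) :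
  avg g * avg h * avg k =
  avg (fun a => avg (fun b => avg (fun c => g a * h b * k c))).
Proof.
rewrite -mulrA -avgZr; apply: eq_avg => a; rewrite -avgZr -avgZ.
by apply: eq_avg => b; rewrite mulrA -avgZ.
Qed.

Lemma avg_sum T (I : Type) (r : seq I) (P : pred I) (f : I -> T -> F) :
  avg (fun t => \sum_(i <- r | P i) f i t) = \sum_(i <- r | P i) avg (f i).
Proof. by rewrite /avg exchange_big mulr_sumr. Qed.

Lemma avg_const T (c : F) : (0 < #|T|)%N -> avg (fun _ : T => c) = c.
Proof.
by move=> T0; rewrite /avg sumr_const -[c *+ _]mulr_natl mulKf // pnatr_eq0 -lt0n.
Qed.

Lemma avg_exchange T U (f : T -> U -> F) :
  avg (fun t => avg (f t)) = avg (fun u => avg (f^~ u)).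
Proof.
rewrite /avg -!mulr_sumr exchange_big /= !mulrA; congr (_ * _).
by rewrite mulrC.
Qed.

Lemma avg_ge0 T (f : T -> F) : (forall t, 0 <= f t) -> 0 <= avg f.
Proof. by move=> f0; rewrite mulr_ge0 ?invr_ge0 ?ler0n ?sumr_ge0. Qed.

Lemma ler_avg T (f g : T -> F) : (forall t, f t <= g t) -> avg f <= avg g.
Proof.
move=> fg; rewrite /avg ler_wpM2l ?invr_ge0 ?ler0n //; exact: ler_sum.
Qed.

Lemma ler_norm_avg T (f : T -> F) : `|avg f| <= avg (fun t => `|f t|).
Proof.
rewrite /avg normrM ger0_norm ?invr_ge0 ?ler0n //.
by rewrite ler_wpM2l ?invr_ge0 ?ler0n // ler_norm_sum.
Qed.

Lemma avg_bij T (h : T -> T) (f : T -> F) :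
  injective h -> avg (fun t => f (h t)) = avg f.
Proof. by move=> hI; rewrite /avg [in RHS](reindex_inj hI). Qed.

Lemma avg_shift (V : finZmodType) (a : V) (f : V -> F) :
  avg (fun t => f (a + t)) = avg f.
Proof. exact/avg_bij/addrI. Qed.

End Average.

Lemma card_rV_gt0 (p m : nat) : (0 < #|{: 'rV['F_p]_m}|)%N.
Proof. by apply/card_gt0P; exists 0. Qed.

Definition proj (F : numFieldType) p m r (N : 'M['F_p]_(r, m))
    (f : 'rV['F_p]_m -> F) y : F :=
  avg (fun w : 'rV_r => f (y + w *m N)).

(** A root of [1 + X + ... + X^(p-1)] has order dividing [p], and order 1 would force [p = 0] in
    [F]. *)
Lemma exists_prim_root (F : numClosedFieldType) (p : nat) :
  prime p -> exists z : F, p.-primitive_root z.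
Proof.
move=> p_pr; have [k pk] : exists k, p = k.+2.
  by case: p p_pr => [|[|k]] // _; exists k.
have /closed_rootP[z] : size (\poly_(i < p) (1 : F)) != 1%N.
  by rewrite size_poly_eq ?pk ?oner_eq0.
rewrite /root horner_poly => /eqP rz; exists z.
have rz' : \sum_(i < p) z ^+ i = 0.
  by rewrite -[RHS]rz; apply: eq_bigr => i _; rewrite mul1r.
have zp : z ^+ p = 1.
  by apply/eqP; rewrite -subr_eq0 subrX1 rz' mulr0.
have [m zm] := prim_order_exists (prime_gt0 p_pr) zp.
case/primeP: (p_pr) => _ pd /pd /orP[] /eqP mE; last by rewrite -mE.
move: zm; rewrite mE => /prim_expr_order; rewrite expr1 => z1.
have : (p%:R : F) = 0.
  rewrite -[RHS]rz' (eq_bigr (fun _ => 1)) ?sumr_const ?card_ord //.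
  by move=> i _; rewrite z1 expr1n.
by move/eqP; rewrite pnatr_eq0 pk.
Qed.

(** * Fourier analysis on F_p^m *)

Section Fourier.
Import mathcomp.algebra_tactics.ring mathcomp.algebra_tactics.lra.
Variables (F : numClosedFieldType) (p : nat) (p_pr : prime p) (z : F).
Hypothesis z_prim : p.-primitive_root z.

Definition addchar (a : 'F_p) : F := z ^+ a.

Lemma addcharD a b : addchar (a + b) = addchar a * addchar b.
Proof.
rewrite /addchar -exprD -(prim_expr_mod z_prim (a + b)%N); congr (_ ^+ _).
by rewrite [LHS]/= {3}(Fp_cast p_pr).
Qed.

Lemma addchar0 : addchar 0 = 1. Proof. by rewrite /addchar expr0. Qed.

Lemma addchar_norm a : `|addchar a| = 1.
Proof.
apply/eqP; rewrite -(@pexpr_eq1 _ _ p) ?prime_gt0 //.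
by rewrite -normrX /addchar exprAC (prim_expr_order z_prim) expr1n normr1.
Qed.

Lemma addcharN a : addchar (- a) = (addchar a)^*.
Proof.
have a0 : addchar a != 0 by rewrite -normr_eq0 addchar_norm oner_eq0.
apply: (mulfI a0); rewrite -addcharD subrr addchar0.
by rewrite -normCK addchar_norm expr1n.
Qed.

Lemma addchar_eq1 a : (addchar a == 1) = (a == 0).
Proof.
rewrite /addchar -[1](expr0 z) (eq_prim_root_expr z_prim) mod0n modn_small //.
by have := ltn_ord a; rewrite [X in (_ < X)%N](Fp_cast p_pr).
Qed.

Definition dot m (u v : 'rV['F_p]_m) : 'F_p := (u *m v^T) 0 0.

Lemma dotDl m (u v w : 'rV['F_p]_m) : dot (u + v) w = dot u w + dot v w.
Proof. by rewrite /dot mulmxDl mxE. Qed.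
Lemma dotDr m (u v w : 'rV['F_p]_m) : dot w (u + v) = dot w u + dot w v.
Proof. by rewrite /dot linearD mulmxDr mxE. Qed.
Lemma dotNl m (u v : 'rV['F_p]_m) : dot (- u) v = - dot u v.
Proof. by rewrite /dot mulNmx mxE. Qed.
Lemma dotNr m (u v : 'rV['F_p]_m) : dot u (- v) = - dot u v.
Proof. by rewrite /dot linearN mulmxN mxE. Qed.
Lemma dotC m (u v : 'rV['F_p]_m) : dot u v = dot v u.
Proof. by rewrite /dot -[u *m v^T]trmxK mxE trmx_mul trmxK. Qed.
Lemma dot_mulmx m r (u : 'rV['F_p]_m) (w : 'rV_r) (N : 'M_(r, m)) :
  dot u (w *m N) = dot (u *m N^T) w.
Proof. by rewrite /dot trmx_mul mulmxA. Qed.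

Lemma dot_nondeg m (u : 'rV['F_p]_m) : u != 0 -> exists v, dot u v != 0.
Proof.
case/rV0Pn=> i ui; exists (delta_mx 0 i).
by rewrite /dot trmx_delta -colE mxE.
Qed.

Lemma avg_addchar m (u : 'rV['F_p]_m) :
  avg (fun v => addchar (dot u v)) = (u == 0)%:R.
Proof.
case: eqP => [->|/eqP /dot_nondeg[w uw]].
  rewrite -[RHS](avg_const _ (card_rV_gt0 p m)); apply: eq_avg => v.
  by rewrite /dot mul0mx mxE addchar0.
have : avg (fun v => addchar (dot u v)) * (addchar (dot u w) - 1) = 0.
  rewrite mulrBr mulr1 mulrC -avgZ -[X in _ - X](avg_shift w).
  by rewrite -avgB; apply/eqP; rewrite mulf_eq0; apply/orP; right; apply/eqP;
     apply: big1 => v _; rewrite dotDr addcharD subrr.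
by move/eqP; rewrite mulf_eq0 subr_eq0 addchar_eq1 (negPf uw) orbF => /eqP.
Qed.

Definition fourier m (f : 'rV['F_p]_m -> F) (c : 'rV['F_p]_m) : F :=
  avg (fun y => f y * addchar (dot c y)).

Lemma sum_addchar m (u : 'rV['F_p]_m) :
  \sum_c addchar (dot c u) = #|{: 'rV['F_p]_m}|%:R * (u == 0)%:R.
Proof.
rewrite -avg_addchar /avg mulrA mulfV ?mul1r.
  by apply: eq_bigr => v _; rewrite dotC.
by rewrite pnatr_eq0 -lt0n card_rV_gt0.
Qed.

Lemma avg_delta m (g : 'rV['F_p]_m -> F) v :
  avg (fun y => g y * (#|{: 'rV['F_p]_m}|%:R * (y == v)%:R)) = g v.
Proof.
rewrite /avg (bigD1 v) //= big1 => [|y /negPf->]; last by rewrite !mulr0.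
rewrite eqxx mulr1 addr0 mulrC mulfK //.
by rewrite pnatr_eq0 -lt0n card_rV_gt0.
Qed.

Lemma fourier_conj m (f : 'rV['F_p]_m -> F) c :
  (forall y, f y \is Num.real) -> (fourier f c)^* = fourier f (- c).
Proof.
move=> fr; rewrite /fourier /avg rmorphM fmorphV rmorph_nat rmorph_sum.
congr (_ * _); apply: eq_bigr => y _ /=.
by rewrite rmorphM /= dotNl addcharN (CrealP (fr y)).
Qed.

Lemma parseval m (f : 'rV['F_p]_m -> F) : (forall y, f y \is Num.real) ->
  \sum_c `|fourier f c| ^+ 2 = avg (fun y => f y ^+ 2).
Proof.
move=> fr; transitivity (\sum_c avg (fun y => avg (fun y' =>
  f y * f y' * addchar (dot c (y' - y))))).
  apply: eq_bigr => c _; rewrite normCK fourier_conj // mulrC.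
  rewrite {1}/fourier -avgZr; apply: eq_avg => y.
  rewrite -avgZ; apply: eq_avg => y'.
  by rewrite dotDr dotNr dotNl addcharD; ring.
rewrite -avg_sum; apply: eq_avg => y; rewrite -avg_sum.
under eq_avg do rewrite -mulr_sumr sum_addchar subr_eq0.
by rewrite avg_delta.
Qed.

(** Expanding the left side over three points [y], [y2], [y3], the sum over [c] forces
    [y3 = 2 y2 - y]; then put [d = y2 - y]. *)
Lemma fourier_ap m (f : 'rV['F_p]_m -> F) :
  \sum_c fourier f c ^+ 2 * fourier f (- (c + c)) =
  avg (fun y => avg (fun d => f y * f (y + d) * f (y + d *+ 2))).
Proof.
transitivity (\sum_c avg (fun y => avg (fun y2 => avg (fun y3 =>
  f y * f y2 * f y3 * addchar (dot c (y3 - (y2 + y2 - y))))))).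
  apply: eq_bigr => c _; rewrite expr2 mulrAC avg_mul3.
  apply: eq_avg => y; apply: eq_avg => y2; apply: eq_avg => y3.
  have -> : dot c (y3 - (y2 + y2 - y)) = dot c y + dot (- (c + c)) y2 + dot c y3.
    by rewrite !(dotDr, dotNr, dotNl, dotDl); ring.
  by rewrite !addcharD; ring.
rewrite -avg_sum; apply: eq_avg => y; rewrite -avg_sum.
rewrite -[RHS](avg_shift (- y)); apply: eq_avg => y2; rewrite -avg_sum.
under eq_avg do rewrite -mulr_sumr sum_addchar subr_eq0.
rewrite avg_delta; congr (_ * _ * _); congr f.
  by rewrite addrA subrr add0r.
by rewrite mulr2n !addrA subrr add0r addrAC.
Qed.

Lemma fourier_proj m r (N : 'M['F_p]_(r, m)) f c :
  fourier (proj N f) c = fourier f c * (c *m N^T == 0)%:R.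
Proof.
rewrite /fourier /proj; under eq_avg do rewrite -avgZr.
rewrite avg_exchange.
transitivity (avg (fun w : 'rV_r => fourier f c * addchar (dot (- c *m N^T) w))).
  apply: eq_avg => w; rewrite /fourier -avgZr -[RHS](avg_shift (w *m N)).
  apply: eq_avg => y; rewrite [w *m N + y]addrC -mulrA -addcharD.
  by rewrite -dot_mulmx dotDr dotNl addrK.
by rewrite avgZ avg_addchar mulNmx oppr_eq0.
Qed.

(** As 2 is invertible, [c] and [-2c] are trivial on the row space of [N] together. If they are, the
    two terms cancel; if not, the coefficient at [-2c] is at most [delta], and Parseval sums the
    remaining squares to at most 1. *)
Lemma ap_avg_proj m r (N : 'M['F_p]_(r, m)) (f : 'rV['F_p]_m -> F) (delta : F) :
  (2 < p)%N -> (forall y, 0 <= f y <= 1) ->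
  (forall c, c *m N^T != 0 -> `|fourier f c| <= delta) -> 0 <= delta ->
  `|avg (fun y => avg (fun d => f y * f (y + d) * f (y + d *+ 2))) -
    avg (fun y => avg (fun d =>
      proj N f y * proj N f (y + d) * proj N f (y + d *+ 2)))| <= delta.
Proof.
move=> p2 f01 fd d0.
have p2N0 : (2%:R : 'F_p) != 0.
  apply/eqP => /(congr1 (@nat_of_ord _)); rewrite (val_Fp_nat p_pr) /=.
  by rewrite modn_small.
have fr y : f y \is Num.real by rewrite realE; case/andP: (f01 y) => ->.
rewrite -!fourier_ap -sumrB; apply: le_trans (ler_norm_sum _ _ _) _.
apply: (@le_trans _ _ (\sum_c `|fourier f c| ^+ 2 * delta)); last first.
  rewrite -mulr_suml parseval // ler_piMl //.
  rewrite -[leRHS](avg_const _ (card_rV_gt0 p m)); apply: ler_avg => y.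
  by case/andP: (f01 y) => y0 y1; rewrite expr_le1.
apply: ler_sum => c _; rewrite !fourier_proj.
have -> : (- (c + c) *m N^T == 0) = (c *m N^T == 0).
  by rewrite mulNmx oppr_eq0 -mulr2n -scaler_nat -scalemxAl scaler_eq0 (negPf p2N0).
case: eqP => [_|/eqP cN]; first by rewrite !mulr1 subrr normr0 mulr_ge0 ?exprn_ge0.
rewrite !mulr0 subr0 normrM normrX ler_wpM2l ?exprn_ge0 // fd //.
by rewrite mulNmx oppr_eq0 -mulr2n -scaler_nat -scalemxAl scaler_eq0 (negPf p2N0).
Qed.

End Fourier.

(** * Progressions inside the cosets of a subspace: Schur's inequality and supersaturation *)

Section Progressions.
Import mathcomp.algebra_tactics.ring mathcomp.algebra_tactics.lra.
Variables (R : realFieldType) (p : nat).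
Hypotheses (p_pr : prime p) (p_gt2 : (2 < p)%N).

(** Only differences in the row space of [M] occur while [x] is free, so this is the mean over all
    cosets of the progression density within a coset. *)
Definition ap_avg n m (g : 'rV['F_p]_n -> R) (M : 'M['F_p]_(m, n)) : R :=
  avg (fun x => avg (fun d => g x * g (x + d *m M) * g (x + (d *m M) *+ 2))).

Lemma avg_fibers n m (M : 'M['F_p]_(m, n)) (h : 'rV['F_p]_n -> R) :
  avg (fun x => avg (fun y => h (x + y *m M))) = avg h.
Proof.
rewrite avg_exchange -[RHS](avg_const _ (card_rV_gt0 p m)); apply: eq_avg => y.
by rewrite -[RHS](avg_shift (y *m M)); apply: eq_avg => x; rewrite addrC.
Qed.

Lemma proj_shift n m (M : 'M['F_p]_(m, n)) (h : 'rV['F_p]_n -> R) x u :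
  proj M h (x + u *m M) = proj M h x.
Proof.
rewrite /proj -[RHS](avg_shift u); apply: eq_avg => w.
by rewrite mulmxDl addrA.
Qed.

Lemma proj_mulmx n m r (M : 'M['F_p]_(m, n)) (N : 'M['F_p]_(r, m)) h x :
  proj M (proj (N *m M) h) x = proj M h x :> R.
Proof.
rewrite /proj avg_exchange -[RHS](avg_const _ (card_rV_gt0 p r)).
apply: eq_avg => w; rewrite -[RHS](avg_shift (w *m N)); apply: eq_avg => u.
by rewrite mulmxDl mulmxA addrA addrAC.
Qed.

Lemma proj_ge0 n m (M : 'M['F_p]_(m, n)) (h : 'rV['F_p]_n -> R) x :
  (forall y, 0 <= h y) -> 0 <= proj M h x.
Proof. by move=> h0; apply: avg_ge0. Qed.

Lemma avg_sqr_ge (T : finType) (h : T -> R) :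
  (0 < #|T|)%N -> avg h ^+ 2 <= avg (fun t => h t ^+ 2).
Proof.
move=> T0; rewrite -subr_ge0.
have -> : avg (fun t => h t ^+ 2) - avg h ^+ 2 = avg (fun t => (h t - avg h) ^+ 2).
  rewrite -[X in _ - X](avg_const _ T0) -avgB.
  rewrite [RHS](_ : _ = avg (fun t => h t ^+ 2 - avg h ^+ 2 + (2%:R * avg h) * (avg h - h t))).
    by rewrite [RHS]avgD avgZ [avg (fun t => avg h - _)]avgB avg_const // subrr mulr0 addr0.
  by apply: eq_avg => t; ring.
by apply: avg_ge0 => t; apply: sqr_ge0.
Qed.

(** Schur's inequality of degree 3. For [a >= b >= c] its symmetric form equals [(a - b)^2 (a + b -
    c) + c (a - c) (b - c)]; the rest is sorting. *)
Lemma schur3 (u v w : R) : 0 <= u -> 0 <= v -> 0 <= w ->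
  u ^+ 2 * v + u ^+ 2 * w + v ^+ 2 * u + v ^+ 2 * w + w ^+ 2 * u + w ^+ 2 * v
  <= u ^+ 3 + v ^+ 3 + w ^+ 3 + 3 * (u * v * w).
Proof.
have ord (a b c : R) : 0 <= c -> c <= b -> b <= a ->
    0 <= a * (a - b) * (a - c) + b * (b - a) * (b - c) + c * (c - a) * (c - b).
  move=> c0 cb ba.
  rewrite [leRHS](_ : _ = (a - b) * (a - b) * (a + b - c) + c * ((a - c) * (b - c))).
    by rewrite addr_ge0 ?mulr_ge0 //; lra.
  by ring.
move=> u0 v0 w0; rewrite -subr_ge0.
have [uv|/ltW uv] := leP u v; have [vw|/ltW vw] := leP v w;
  have [uw|/ltW uw] := leP u w.
- by have := ord w v u u0 uv vw; nra.
- by have := ord w v u u0 uv vw; nra.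
- by have := ord v w u u0 uw vw; nra.
- by have := ord v u w w0 uw uv; nra.
- by have := ord w u v v0 uv uw; nra.
- by have := ord u w v v0 vw uw; nra.
- by have := ord u v w w0 vw uv; nra.
- by have := ord u v w w0 vw uv; nra.
Qed.

Lemma natr_Fp_neq0 k : (0 < k < p)%N -> (k%:R : 'F_p) != 0.
Proof.
case/andP=> k0 kp; apply/eqP => /(congr1 (@nat_of_ord _)).
by rewrite (val_Fp_nat p_pr) /= modn_small // => kE; rewrite kE in k0.
Qed.

Lemma avg_scale m (c : 'F_p) (h : 'rV['F_p]_m -> R) :
  c != 0 -> avg (fun d => h (c *: d)) = avg h.
Proof. by move=> c0; apply/avg_bij/scalerI. Qed.

(* Any two terms of a progression are an independent pair within their coset. *)
Lemma avg_two_terms n m (M : 'M['F_p]_(m, n)) (g : 'rV['F_p]_n -> R) (i j : 'F_p) :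
  (forall x, 0 <= g x) -> i != j ->
  avg (fun x => proj M g x ^+ 3) <=
  avg (fun x => avg (fun d => g (x + i *: (d *m M)) ^+ 2 * g (x + j *: (d *m M)))).
Proof.
move=> g0 ij.
have -> : avg (fun x => avg (fun d =>
    g (x + i *: (d *m M)) ^+ 2 * g (x + j *: (d *m M)))) =
    avg (fun x => g x ^+ 2 * proj M g x).
  rewrite avg_exchange.
  transitivity (avg (fun d : 'rV['F_p]_m => avg (fun x : 'rV['F_p]_n =>
      g x ^+ 2 * g (x + ((j - i) *: d) *m M)))).
    apply: eq_avg => d; rewrite -[RHS](avg_shift (i *: (d *m M))).
    apply: eq_avg => x; rewrite [i *: _ + x]addrC; congr (_ * g _).
    by rewrite -scalemxAl -addrA -scalerDl [i + _]addrC subrK.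
  rewrite avg_exchange; apply: eq_avg => x; rewrite avgZ; congr (_ * _).
  by apply: (avg_scale (fun d => g (x + d *m M))); rewrite subr_eq0 eq_sym.
(* On one coset the claim is mean(g)^3 <= mean(g^2) mean(g), by Cauchy-Schwarz. *)
rewrite -[leRHS](avg_fibers M); apply: ler_avg => x.
under eq_avg do rewrite proj_shift.
rewrite avgZr exprSr ler_wpM2r ?proj_ge0 //.
exact: (avg_sqr_ge (fun u : 'rV_m => g (x + u *m M)) (card_rV_gt0 p m)).
Qed.

Lemma avg_term n m (M : 'M['F_p]_(m, n)) (h : 'rV['F_p]_n -> R) (i : 'F_p) :
  avg (fun x => avg (fun d : 'rV_m => h (x + i *: (d *m M)))) = avg h.
Proof.
rewrite avg_exchange -[RHS](avg_const _ (card_rV_gt0 p m)); apply: eq_avg => d.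
by rewrite -[RHS](avg_shift (i *: (d *m M))); apply: eq_avg => x; rewrite addrC.
Qed.

(** Schur's inequality is averaged over the three terms of a progression: each of the six mixed
    means is at least [B] and each of the three cubes has mean [D], so [6 B <= 3 D + 3 T]. *)
Lemma ap_avg_schur n m (M : 'M['F_p]_(m, n)) (g : 'rV['F_p]_n -> R) :
  (forall x, 0 <= g x) ->
  2 * avg (fun x => proj M g x ^+ 3) - avg (fun x => g x ^+ 3) <= ap_avg g M.
Proof.
move=> g0.
have n01 : (0 : 'F_p) != 1 by rewrite eq_sym oner_eq0.
have n02 : (0 : 'F_p) != 2%:R by rewrite eq_sym natr_Fp_neq0.
have n12 : (1 : 'F_p) != 2%:R.
  by rewrite eq_sym -subr_eq0 mulr2n addrK oner_eq0.
set B := avg (fun x => proj M g x ^+ 3); set D := avg (fun x => g x ^+ 3).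
pose t (i : 'F_p) x (d : 'rV_m) := g (x + i *: (d *m M)).
pose A2 i j := avg (fun x => avg (fun d => t i x d ^+ 2 * t j x d)).
pose A3 i := avg (fun x => avg (fun d => t i x d ^+ 3)).
have A2B i j : i != j -> B <= A2 i j by exact: avg_two_terms.
have A3D i : A3 i = D by exact: (avg_term M (fun x => g x ^+ 3)).
have -> : ap_avg g M = avg (fun x => avg (fun d => t 0 x d * t 1 x d * t 2%:R x d)).
  apply: eq_avg => x; apply: eq_avg => d.
  by rewrite /t scale0r scale1r addr0 scaler_nat.
have := A2B _ _ n01; have := A2B _ _ n02; have := A2B _ _ n12.
rewrite eq_sym in n01; rewrite eq_sym in n02; rewrite eq_sym in n12.
have := A2B _ _ n01; have := A2B _ _ n02; have := A2B _ _ n12.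
set T := avg _.
have : A2 0 1 + A2 0 2%:R + A2 1 0 + A2 1 2%:R + A2 2%:R 0 + A2 2%:R 1 <=
    A3 0 + A3 1 + A3 2%:R + 3 * T.
  rewrite /A2 /A3 /T -avgZ -!avgD; apply: ler_avg => x.
  by rewrite -avgZ -!avgD; apply: ler_avg => d; apply: schur3; apply: g0.
rewrite !A3D; move: (A2 _ _) (A2 _ _) (A2 _ _) (A2 _ _) (A2 _ _) (A2 _ _).
move=> a1 a2 a3 a4 a5 a6; clearbody B D T; clear -B D T a1 a2 a3 a4 a5 a6.
by move=> *; lra.
Qed.

(** If the level set [X] at half the mean has density at least [1 / (4 mu)], it supplies
    progressions of weight at least [(a / 2)^3] each; otherwise at least half of the mass sits on a
    sparse set and the mean cube is at least [mu^2 a^3]. The alternative is stated as one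
    inequality, linear in the two averages, so that it can be averaged over cosets. *)
Lemma avg_cube_ge_or_ap_ge m (f : 'rV['F_p]_m -> R) (mu kappa : R) :
  (forall y, 0 <= f y) -> 0 < mu -> 0 <= kappa ->
  (forall X : {set 'rV['F_p]_m},
     (4 * mu)^-1 <= #|X|%:R / #|{: 'rV['F_p]_m}|%:R ->
     kappa <= avg (fun y => avg (fun d =>
       ([&& y \in X, y + d \in X & y + d *+ 2 \in X])%:R))) ->
  kappa * mu ^+ 2 * avg f ^+ 3 <=
  kappa * avg (fun y => f y ^+ 3) +
  8 * mu ^+ 2 * avg (fun y => avg (fun d => f y * f (y + d) * f (y + d *+ 2))).
Proof.
move=> f0 mu0 k0 sup; set a := avg f; set L := avg (fun y => avg _).
have a0 : 0 <= a by apply: avg_ge0.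
have L0 : 0 <= L by do 2!apply: avg_ge0 => ?; rewrite !mulr_ge0.
have c0 : 0 <= avg (fun y => f y ^+ 3) by apply: avg_ge0 => y; rewrite exprn_ge0.
pose X := [set y | a / 2 <= f y].
have [/sup{sup} supX|xlt] := leP (4 * mu)^-1 (#|X|%:R / #|{: 'rV['F_p]_m}|%:R).
  have : kappa * (a / 2) ^+ 3 <= L.
    rewrite mulrC; apply: (@le_trans _ _ ((a / 2) ^+ 3 *
      avg (fun y => avg (fun d => ([&& y \in X, y + d \in X & y + d *+ 2 \in X])%:R)))).
      by rewrite ler_wpM2l // exprn_ge0 // divr_ge0.
    rewrite -avgZ; apply: ler_avg => y; rewrite -avgZ; apply: ler_avg => d.
    rewrite !inE; have a20 : 0 <= a / 2 by lra.
    case: and3P => [[h1 h2 h3]|_]; last by rewrite mulr0 !mulr_ge0.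
    rewrite mulr1 (_ : (a / 2) ^+ 3 = a / 2 * (a / 2) * (a / 2)); last by ring.
    by apply: ler_pM => //; [apply: mulr_ge0 | apply: ler_pM].
  move=> h; have : 0 <= kappa * avg (fun y => f y ^+ 3) by rewrite mulr_ge0.
  have : 0 <= mu ^+ 2 by rewrite sqr_ge0.
  set c := avg _; set m2 := mu ^+ 2 => m20 kc0.
  have : 8 * m2 * (kappa * (a / 2) ^+ 3) <= 8 * m2 * L by rewrite ler_wpM2l // mulr_ge0 ?ler0n.
  have -> : 8 * m2 * (kappa * (a / 2) ^+ 3) = kappa * m2 * a ^+ 3 by field.
  by move: (kappa * m2 * _) => q; lra.
suff h : mu ^+ 2 * a ^+ 3 <= avg (fun y => f y ^+ 3).
  rewrite -[leLHS]addr0; apply: lerD.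
    by rewrite -mulrA; apply: ler_wpM2l.
  by apply: mulr_ge0 => //; apply: mulr_ge0; rewrite ?ler0n ?sqr_ge0.
pose t := mu * a.
have t0 : 0 <= t by rewrite mulr_ge0 // ltW.
(* Tangent line of the cube at [t], used on [X] only. *)
have tg : avg (fun y => 3 * t ^+ 2 * (f y - a / 2) - 2 * t ^+ 3 * (y \in X)%:R)
    <= avg (fun y => f y ^+ 3).
  apply: ler_avg => y; rewrite inE; have fy := f0 y.
  case: (leP (a / 2) (f y)) => [h|/ltW h]; rewrite ?mulr1 ?mulr0 ?subr0; last first.
    apply: (@le_trans _ _ 0); last exact: exprn_ge0.
    by apply: mulr_ge0_le0; rewrite ?subr_le0 // mulr_ge0 ?ler0n ?sqr_ge0.
  have : 0 <= (f y - t) ^+ 2 * (f y + 2 * t) by rewrite mulr_ge0 ?sqr_ge0 //; lra.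
  have : 0 <= t ^+ 2 * a by rewrite mulr_ge0 ?sqr_ge0.
  by move: (f y) => u; nra.
apply: le_trans tg; rewrite avgB !avgZ avgB (avg_const _ (card_rV_gt0 p m)) -/a.
have -> : avg (fun y => (y \in X)%:R) = #|X|%:R / #|{: 'rV['F_p]_m}|%:R :> R.
  rewrite /avg mulrC; congr (_ / _); rewrite -sum1_card natr_sum [in RHS]big_mkcond /=.
  by apply: eq_bigr => y _; case: ifP.
set x := (_ / _) in xlt *.
have xm : 4 * mu * x <= 1.
  by have := ltW xlt; rewrite -(ler_pM2l (_ : 0 < 4 * mu)) ?divff //; nra.
(* The tangent bound has mean [(3 / 2) mu^2 a^3 - 2 mu^3 a^3 x], and [4 mu x <= 1]. *)
have : 0 <= (mu ^+ 2 * a ^+ 3) * (1 - 4 * mu * x).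
  by rewrite mulr_ge0 ?subr_ge0 // mulr_ge0 ?sqr_ge0 ?exprn_ge0.
by rewrite /t; nra.
Qed.

Lemma ap_avg_supersat n m (M : 'M['F_p]_(m, n)) (g : 'rV['F_p]_n -> R) (mu kappa : R) :
  (forall y, 0 <= g y) -> 0 < mu -> 0 <= kappa ->
  (forall X : {set 'rV['F_p]_m},
     (4 * mu)^-1 <= #|X|%:R / #|{: 'rV['F_p]_m}|%:R ->
     kappa <= avg (fun y => avg (fun d =>
       ([&& y \in X, y + d \in X & y + d *+ 2 \in X])%:R))) ->
  kappa * mu ^+ 2 * avg (fun x => proj M g x ^+ 3) <=
  kappa * avg (fun y => g y ^+ 3) + 8 * mu ^+ 2 * ap_avg g M.
Proof.
move=> g0 mu0 k0 sup.
rewrite -avgZ -[avg (fun y => g y ^+ 3)](avg_fibers M) -avgZ.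
rewrite /ap_avg -[avg (fun x => avg (fun d => _))](avg_fibers M) -avgZ -avgD.
apply: ler_avg => x.
have h := @avg_cube_ge_or_ap_ge m (fun y => g (x + y *m M)) mu kappa
  (fun y => g0 _) mu0 k0 sup.
apply: le_trans h _; rewrite lerD2l; apply: ler_wpM2l.
  by rewrite mulr_ge0 ?ler0n ?sqr_ge0.
apply: ler_avg => y; apply: ler_avg => d.
by rewrite mulmxDl mulmxDl [(d *+ 2) *m M]mulmxDl mulr2n !addrA.
Qed.

End Progressions.

(** * Refining a subspace by its large Fourier coefficients *)

Section Refinement.
Import mathcomp.algebra_tactics.ring mathcomp.algebra_tactics.lra.
Variables (R : rcfType) (p : nat).
Hypotheses (p_pr : prime p) (p_gt2 : (2 < p)%N).
Local Open Scope complex_scope.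

Lemma real_complex_avg (T : finType) (g : T -> R) :
  (avg g)%:C = avg (fun t => (g t)%:C) :> R[i].
Proof. by rewrite /avg rmorphM fmorphV rmorph_nat rmorph_sum. Qed.

Lemma card_rV_Fp m : #|{: 'rV['F_p]_m}| = (p ^ m)%N.
Proof. by rewrite card_mx card_Fp // mul1n. Qed.

Variables (z : R[i]) (z_prim : p.-primitive_root z).
Variables (n : nat) (f : 'rV['F_p]_n -> R).
Hypothesis f01 : forall x, 0 <= f x <= 1.

Definition local_fourier m (M : 'M['F_p]_(m, n)) x (c : 'rV['F_p]_m) : R[i] :=
  fourier z (fun y => (f (x + y *m M))%:C) c.

Lemma local_fourier_shift m (M : 'M['F_p]_(m, n)) x u c :
  `|local_fourier M (x + u *m M) c| = `|local_fourier M x c|.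
Proof.
rewrite -[RHS]mulr1 -(addchar_norm p_pr z_prim (- dot c u)) -normrM; congr `|_|.
rewrite /local_fourier /fourier -avgZr -[RHS](avg_shift u); apply: eq_avg => y.
rewrite mulmxDl addrA -mulrA -(addcharD p_pr z_prim) dotDr.
by congr (_ * addchar _ _); ring.
Qed.

Lemma local_parseval m (M : 'M['F_p]_(m, n)) x :
  \sum_c `|local_fourier M x c| ^+ 2 <= 1.
Proof.
rewrite parseval //; last first.
  move=> y; rewrite realE -(rmorph0 (real_complex R)) lecR.
  by case/andP: (f01 (x + y *m M)) => ->.
rewrite -(avg_const (1 : R[i]) (card_rV_gt0 p m)); apply: ler_avg => y.
case/andP: (f01 (x + y *m M)) => y0 y1.
by rewrite -rmorphXn -(rmorph1 (real_complex R)) lecR expr_le1.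
Qed.

(** Being large on one coset is enough to belong, so a single annihilator works on every coset at
    once. *)
Definition spectrum m (M : 'M['F_p]_(m, n)) (delta : R) : {set 'rV['F_p]_m} :=
  [set c | [exists x, delta%:C < `|local_fourier M x c|]].

(** Double counting of pairs [(c, x)]: Parseval allows total weight 1 for each of the [p^n] points
    [x], while a [c] that is large at one point is large on its whole coset, that is at [p^m]
    points. *)
Lemma card_spectrum m (M : 'M['F_p]_(m, n)) delta : row_free M -> 0 < delta ->
  #|spectrum M delta|%:R * delta ^+ 2 <= (p ^ (n - m))%:R.
Proof.
move=> Mfree d0.
have mn : (m <= n)%N by rewrite -(eqP Mfree) rank_leq_col.
have pm0 : (0 : R) < (p ^ m)%:R by rewrite ltr0n expn_gt0 prime_gt0.
rewrite -(ler_pM2l pm0) -natrM -expnD subnKC // -lecR.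
rewrite rmorphM /= rmorphM /= !rmorph_nat.
apply: (@le_trans _ _ (\sum_c \sum_x `|local_fourier M x c| ^+ 2)); last first.
  rewrite exchange_big /= -card_rV_Fp -sum1_card natr_sum.
  by apply: ler_sum => x _; apply: local_parseval.
rewrite [leRHS](bigID [in spectrum M delta]) /=.
rewrite -[leLHS]addr0; apply: lerD; last first.
  by apply: sumr_ge0 => c _; apply: sumr_ge0 => x _; apply: exprn_ge0.
rewrite mulrCA -sum1_card natr_sum mulr_suml; apply: ler_sum => c.
rewrite inE mul1r => /existsP[x0 /ltW x0P].
pose h (u : 'rV['F_p]_m) := x0 + u *m M.
have hI : injective h by move=> u v /addrI /(row_free_inj Mfree).
rewrite [leRHS](bigID [in h @: [set: 'rV['F_p]_m]]) /=.
rewrite -[leLHS]addr0; apply: lerD; last first.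
  by apply: sumr_ge0 => x _; apply: exprn_ge0.
rewrite big_imset /=; last by move=> u v _ _; apply: hI.
rewrite -card_rV_Fp -cardsT -sum1_card natr_sum mulr_suml; apply: ler_sum => u _.
have dC0 : 0 <= delta%:C by rewrite -(rmorph0 (real_complex R)) lecR ltW.
by rewrite mul1r local_fourier_shift [(delta ^+ 2)%:C]rmorphXn ler_pXn2r // nnegrE.
Qed.

(** [N] is a basis of the left kernel of the matrix whose columns are the elements of [S], and that
    matrix has rank at most [#|S|]. *)
Lemma exists_annihilator m (S : {set 'rV['F_p]_m}) :
  exists r (N : 'M['F_p]_(r, m)),
    [/\ row_free N, (m - r <= #|S|)%N & forall c, c \in S -> c *m N^T = 0].
Proof.
pose A : 'M['F_p]_(m, #|S|) := \matrix_(i, j) (@enum_val _ (mem S) j : 'rV_m) 0 i.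
exists _, (row_base (kermx A)); split; first exact: row_base_free.
  rewrite mxrank_ker leq_subLR addnC -leq_subLR leq_sub2l ?rank_leq_col //.
move=> c cS.
have NA0 : row_base (kermx A) *m A = 0.
  by apply/sub_kermxP; rewrite eq_row_base.
have -> : c = (col (enum_rank_in cS c) A)^T.
  by apply/rowP => i; rewrite !mxE enum_rankK_in.
by rewrite -trmx_mul colE mulmxA NA0 mul0mx trmx0.
Qed.

Theorem ap_avg_refine m (M : 'M['F_p]_(m, n)) (delta : R) :
  row_free M -> 0 < delta ->
  exists r (N : 'M['F_p]_(r, m)),
    [/\ row_free (N *m M),
        (n - r)%:R <= (n - m)%:R + (p ^ (n - m))%:R / delta ^+ 2 &
        `|ap_avg f M - ap_avg (proj (N *m M) f) M| <= delta].
Proof.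
move=> Mfree d0.
have [r [N [Nfree rS NS]]] := exists_annihilator (spectrum M delta).
have mn : (m <= n)%N by rewrite -(eqP Mfree) rank_leq_col.
exists r, N; split.
- by rewrite /row_free mxrankMfree.
- have rm : (r <= m)%N by rewrite -(eqP Nfree) rank_leq_col.
  have -> : (n - r = (n - m) + (m - r))%N by rewrite addnBA // subnK.
  rewrite natrD lerD2l ler_pdivlMr ?exprn_gt0 //.
  apply: le_trans (card_spectrum Mfree d0).
  by rewrite ler_wpM2r ?sqr_ge0 // ler_nat.
rewrite /ap_avg -[avg (fun x => avg (fun d => f x * _ * _))](avg_fibers M).
rewrite -[avg (fun x => avg (fun d => proj _ _ _ * _ * _))](avg_fibers M).
rewrite -avgB; apply: le_trans (ler_norm_avg _) _.
rewrite -[leRHS](avg_const _ (card_rV_gt0 p n)); apply: ler_avg => x.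
pose F (y : 'rV['F_p]_m) : R[i] := (f (x + y *m M))%:C.
have F01 y : 0 <= F y <= 1.
  by rewrite -(rmorph0 (real_complex R)) -(rmorph1 (real_complex R)) !lecR.
have dC0 : 0 <= delta%:C by rewrite -(rmorph0 (real_complex R)) lecR ltW.
have FN c : c *m N^T != 0 -> `|fourier z F c| <= delta%:C.
  move=> cN; rewrite real_leNgt ?ger0_real // ; apply/negP => lt.
  case/eqP: cN; apply: NS; rewrite inE; apply/existsP; exists x; exact: lt.
have := ap_avg_proj p_pr z_prim p_gt2 F01 FN dC0.
have projF y : proj N F y = (proj (N *m M) f (x + y *m M))%:C.
  rewrite /proj real_complex_avg; apply: eq_avg => w.
  by rewrite /F mulmxDl mulmxA addrA.
have E (g : 'rV['F_p]_n -> R) : avg (fun y => avg (fun d => (g (x + y *m M))%:C *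
      (g (x + (y + d) *m M))%:C * (g (x + (y + d *+ 2) *m M))%:C)) =
    (avg (fun y => avg (fun d => g (x + y *m M) * g (x + y *m M + d *m M) *
      g (x + y *m M + (d *m M) *+ 2))))%:C.
  rewrite real_complex_avg; apply: eq_avg => y.
  rewrite real_complex_avg; apply: eq_avg => d.
  rewrite !rmorphM mulmxDl mulmxDl !mulr2n mulmxDl.
  by rewrite !addrA.
have -> : avg (fun y => avg (fun d => proj N F y * proj N F (y + d) *
    proj N F (y + d *+ 2))) = avg (fun y => avg (fun d =>
    (proj (N *m M) f (x + y *m M))%:C * (proj (N *m M) f (x + (y + d) *m M))%:C *
    (proj (N *m M) f (x + (y + d *+ 2) *m M))%:C)).
  by apply: eq_avg => y; apply: eq_avg => d; rewrite !projF.
by rewrite !E -rmorphB /= normc_def /= expr0n /= addr0 sqrtr_sqr lecR.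
Qed.

End Refinement.

(** * The increment of the mean cube in one refinement *)

Section Increment.
Import mathcomp.algebra_tactics.ring mathcomp.algebra_tactics.lra.
Variables (p : nat) (Cp : R).
Hypotheses (p_pr : prime p) (p_gt2 : (2 < p)%N).
Hypothesis Cp_sup : supersat p Cp.

Lemma supersat_avg m (X : {set 'rV['F_p]_m}) (x : R) :
  (0 < m)%N -> 0 <= Cp -> 0 < x -> x <= #|X|%:R / #|{: 'rV['F_p]_m}|%:R ->
  Rpower x Cp <= avg (fun y => avg (fun d =>
       ([&& y \in X, y + d \in X & y + d *+ 2 \in X])%:R)).
Proof.
move=> m0 C0 x0 xX.
have pm0 : (0 : R) < (p ^ m)%:R by rewrite ltr0n expn_gt0 prime_gt0.
have -> : avg (fun y => avg (fun d =>
    ([&& y \in X, y + d \in X & y + d *+ 2 \in X])%:R)) =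
    (ap_pairs X)%:R / (p ^ (2 * m))%:R :> R.
  rewrite /avg -mulr_sumr !card_rV_Fp // mulrA mulrC mul2n -addnn expnD natrM invfM.
  congr (_ * _); rewrite pair_big /= /ap_pairs -sum1_card natr_sum [in RHS]big_mkcond /=.
  by apply: eq_bigr => -[y d] _; rewrite inE /=; case: ifP.
rewrite ler_pdivlMr; last by rewrite ltr0n expn_gt0 prime_gt0.
have /RleP := @Cp_sup m X m0; rewrite RmultE !INRE.
apply: le_trans; rewrite ler_wpM2r ?ler0n //.
have dE : density X = #|X|%:R / #|{: 'rV['F_p]_m}|%:R.
  by rewrite /density RdivE !INRE card_rV_Fp.
rewrite /rpow dE; case: Rle_dec => h /=.
  by have /RleP := h; rewrite leNgt (lt_le_trans x0 xX).
by apply/RleP/Rle_Rpower_l; [exact/RleP|split; [exact/RltP|exact/RleP]].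
Qed.

Variables (n : nat) (A : {set 'rV['F_p]_n}) (beta : R).
Hypothesis beta_ge0 : 0 <= beta.
Hypothesis unpopular : forall d, nonzero_vec d -> Rlt (ap_density A d) beta.

Definition indic (x : 'rV['F_p]_n) : R := (x \in A)%:R.

Definition mean_cube m (M : 'M['F_p]_(m, n)) : R := avg (fun x => proj M indic x ^+ 3).

Lemma indic01 x : 0 <= indic x <= 1.
Proof. by rewrite /indic; case: (x \in A); rewrite ?lexx ?ler01. Qed.

Lemma indic_ge0 x : 0 <= indic x. Proof. by case/andP: (indic01 x). Qed.

Lemma avg_indic : avg indic = density A.
Proof.
rewrite /density RdivE !INRE /avg card_rV_Fp // mulrC; congr (_ / _).
rewrite -sum1_card natr_sum [in RHS]big_mkcond /=.
by apply: eq_bigr => y _; rewrite /indic; case: ifP.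
Qed.

Lemma proj_indic01 m (M : 'M['F_p]_(m, n)) x : 0 <= proj M indic x <= 1.
Proof.
rewrite proj_ge0 /=; last exact: indic_ge0.
rewrite -[leRHS](avg_const _ (card_rV_gt0 p m)); apply: ler_avg => w.
by case/andP: (indic01 (x + w *m M)).
Qed.

Lemma mean_cube_le m (M : 'M['F_p]_(m, n)) : mean_cube M <= density A.
Proof.
rewrite -avg_indic -(avg_fibers M indic); apply: ler_avg => x.
have /andP[g0 g1] := proj_indic01 M x.
by rewrite exprSr ler_piMl // expr_le1.
Qed.

Lemma mean_cube1 : mean_cube (1%:M : 'M['F_p]_n) = density A ^+ 3.
Proof.
rewrite -avg_indic -[RHS](avg_const _ (card_rV_gt0 p n)); apply: eq_avg => x.
congr (_ ^+ 3); rewrite /proj -[RHS](avg_shift x).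
by apply: eq_avg => y; rewrite mulmx1.
Qed.

(** The zero difference contributes at most [p^-m]; row freeness makes every other [d *m M] nonzero,
    hence unpopular. *)
Lemma ap_avg_indic_le m (M : 'M['F_p]_(m, n)) : row_free M ->
  ap_avg indic M <= (p ^ m)%:R^-1 + beta.
Proof.
move=> Mfree; rewrite /ap_avg avg_exchange.
set h := fun d => avg _.
have hE d : h d = ap_density A (d *m M).
  rewrite /ap_density RdivE !INRE /h /avg card_rV_Fp // mulrC; congr (_ / _).
  rewrite -sum1_card natr_sum [in RHS]big_mkcond /=.
  apply: eq_bigr => y _; rewrite inE /indic.
  by do 3!case: (_ \in A); rewrite /= ?mulr0 ?mul0r ?mulr1.
have h1 d : h d <= 1.
  rewrite -[leRHS](avg_const _ (card_rV_gt0 p n)); apply: ler_avg => x.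
  have /andP[a0 a1] := indic01 x; have /andP[b0 b1] := indic01 (x + d *m M).
  have /andP[c0 c1] := indic01 (x + (d *m M) *+ 2).
  by rewrite -[leRHS]mulr1 ler_pM ?mulr_ge0 // -[leRHS]mulr1 ler_pM.
rewrite /avg (bigD1 0) //= card_rV_Fp // mulrDr.
have pm0 : (0 : R) < (p ^ m)%:R by rewrite ltr0n expn_gt0 prime_gt0.
apply: lerD; first by rewrite ler_piMr ?invr_ge0 ?ler0n.
rewrite mulrC ler_pdivrMr // -card_rV_Fp // -sum1_card natr_sum mulr_sumr.
rewrite [leRHS](bigID [pred d | d != 0]) /= -[leLHS]addr0; apply: lerD.
  apply: ler_sum => d d0; rewrite mulr1 hE; apply/ltW/RltP/unpopular.
  rewrite /nonzero_vec; apply: contraNneq d0 => dM0.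
  by apply/eqP/(row_free_inj Mfree); rewrite dM0 mul0mx.
by apply: sumr_ge0 => d _; rewrite mulr1.
Qed.

(** In [beta + 2 * delta] one [delta] pays for the zero difference and one for replacing the
    indicator of [A] by its average over the cosets of the smaller subspace. The last bound is the
    supersaturation inequality divided by [kappa = (4 mu)^-Cp]. *)
Lemma mean_cube_step m (M : 'M['F_p]_(m, n)) (delta : R) :
  row_free M -> 0 < delta < 1 -> (p ^ m)%:R^-1 <= delta -> 0 <= Cp ->
  exists r (M' : 'M['F_p]_(r, n)),
    [/\ row_free M', (n - r)%:R <= (n - m)%:R + (p ^ (n - m))%:R / delta ^+ 2 :> R,
        2 * mean_cube M - (beta + 2 * delta) <= mean_cube M' &
        forall mu, 0 < mu -> mu ^+ 2 * (mean_cube M - 8 * Rpower (4 * mu) Cp *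
          (beta + 2 * delta)) <= mean_cube M'].
Proof.
move=> Mfree /andP[d0 d1] pmd C0.
(* [supersat] says nothing in dimension 0, which [p^-m <= delta < 1] excludes. *)
have m0 : (0 < m)%N.
  by case: m M Mfree pmd => // M _; rewrite expn0 invr1 leNgt d1.
have [z zP] := exists_prim_root (complex R) p_pr.
have [r [N [Nfree rn close]]] := ap_avg_refine p_pr p_gt2 zP indic01 Mfree d0.
set M' := N *m M in Nfree close *; exists r, M'; split=> //.
all: have apM' : ap_avg (proj M' indic) M <= beta + 2 * delta
  by have := ap_avg_indic_le Mfree; move: close; rewrite ler_norml => /andP[]; lra.
all: have g0 x : 0 <= proj M' indic x by case/andP: (proj_indic01 M' x).
all: have PM x : proj M (proj M' indic) x = proj M indic x by exact: proj_mulmx.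
  have := ap_avg_schur p_pr p_gt2 M g0.
  under eq_avg do rewrite PM.
  by rewrite -/(mean_cube M) -/(mean_cube M'); lra.
move=> mu mu0; pose kappa := Rpower (4 * mu)^-1 Cp.
have mu40 : 0 < 4 * mu by rewrite mulr_gt0.
have k0 : 0 < kappa by apply/RltP/exp_pos.
have kE : Rpower (4 * mu) Cp * kappa = 1.
  rewrite (_ : Rmult _ _ = 4 * mu :> R); last by rewrite !RealsE.
  have lnV : ln ((4 * mu)^-1)%R = - ln (4 * mu)%R.
    by rewrite -RinvE ln_Rinv; last exact/RltP.
  rewrite /kappa /Rpower lnV; move: (ln _) => l; rewrite -[LHS]RmultE -exp_plus.
  by rewrite RplusE !RmultE mulrN (_ : _ - _ = R0) ?exp_0 // subrr.
have m40 : 0 < (4 * mu)^-1 by rewrite invr_gt0.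
have := ap_avg_supersat M g0 mu0 (ltW k0) (fun X xX => supersat_avg m0 C0 m40 xX).
rewrite -/(mean_cube M').
under eq_avg do rewrite PM.
rewrite -/(mean_cube M) => h.
rewrite -(ler_pM2l k0); apply: (@le_trans _ _ (kappa * mu ^+ 2 * mean_cube M -
  8 * mu ^+ 2 * (beta + 2 * delta))).
  by rewrite le_eqVlt; apply/orP; left; apply/eqP; rewrite -[8 in RHS]mulr1 -kE; ring.
rewrite lerBlDr; apply: le_trans h _; rewrite lerD2l ler_wpM2l //.
by rewrite mulr_ge0 ?ler0n ?sqr_ge0.
Qed.

End Increment.

Local Open Scope R_scope.

(** * Iterating the increment while the dimension lasts *)

Section Sequence.
Variables (p : nat) (C : R) (n : nat) (A : {set 'rV['F_p]_n}) (beta delta : R).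
Hypotheses (p_pr : prime p) (p_gt2 : (2 < p)%N) (C_sup : supersat p C).
Hypotheses (C_ge0 : 0 <= C) (beta_ge0 : 0 <= beta) (delta01 : 0 < delta < 1).
Hypothesis unpopular : forall d, nonzero_vec d -> ap_density A d < beta.

Let Q := / delta ^ 2.

Lemma inv_sqr_ge1 : 1 <= Q.
Proof.
have [d0 d1] := delta01; rewrite -Rinv_1; apply: Rinv_le_contravar; nra.
Qed.

Lemma INR_p_ge3 : 3 <= INR p.
Proof. by have := le_INR 3 p; rewrite /=; move=> h; have := h (ssrnat.leP p_gt2); lra. Qed.

(** Here [p^k >= k >= 2 Q - 1 >= Q >= 1 / delta]. The [+ 1] leaves room for rounding the threshold
    on [n] down to an integer. *)
Lemma inv_pow_le_delta k : 2 * Q <= INR k + 1 -> / INR (expn p k) <= delta.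
Proof.
move=> kQ; have [d0 d1] := delta01; have Q1 := inv_sqr_ge1.
have p3 := INR_p_ge3.
rewrite INR_expn -Rpower_pow; last lra.
have h : INR k <= Rpower (INR p) (INR k) by apply: Rpower_ge_id; [lra | apply: pos_INR].
have dQ : delta = / (Q * delta) by rewrite /Q; field; lra.
rewrite dQ; apply: Rinv_le_contravar; first nra.
nra.
Qed.

Lemma mean_cube_step_R m (M : 'M['F_p]_(m, n)) :
  row_free M -> 2 * Q <= INR m + 1 ->
  exists r (M' : 'M['F_p]_(r, n)),
    [/\ row_free M', INR (n - r) <= INR (n - m) + Q * Rpower (INR p) (INR (n - m)),
        2 * mean_cube A M - (beta + 2 * delta) <= mean_cube A M' &
        forall mu, 0 < mu -> mu ^ 2 * (mean_cube A M - 8 * Rpower (4 * mu) C *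
          (beta + 2 * delta)) <= mean_cube A M'].
Proof.
move=> Mfree mQ; have p3 := INR_p_ge3.
have b0 : (0 <= beta)%R by apply/RleP.
have d01 : (0 < delta < 1)%R by apply/andP; split; apply/RltP; case: delta01.
have C0 : (0 <= C)%R by apply/RleP.
have pmd : ((p ^ m)%:R^-1 <= delta)%R.
  by apply/RleP; rewrite -INRE -RinvE; apply: inv_pow_le_delta.
have [r [M' [M'free h1 h2 h3]]] :=
  mean_cube_step p_pr p_gt2 C_sup b0 unpopular Mfree d01 pmd C0.
exists r, M'; split=> //.
- rewrite Rpower_pow -?INR_expn; last lra.
  by apply/RleP; rewrite /Q Rmult_comm !RealsE.
- by apply/RleP; rewrite !RealsE.
- move=> mu /RltP mu0; apply/RleP; have := h3 _ mu0.
  by rewrite !RealsE.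
Qed.

Lemma increment_sequence s : tow (INR p) s (2 * Q) <= INR n + 1 ->
  exists b : nat -> R, [/\ b 0%N = density A ^ 3,
    forall j, (j <= s)%N -> b j <= density A,
    forall j, (j < s)%N -> 2 * b j - (beta + 2 * delta) <= b j.+1 &
    forall j, (j < s)%N -> forall mu, 0 < mu ->
      mu ^ 2 * (b j - 8 * Rpower (4 * mu) C * (beta + 2 * delta)) <= b j.+1].
Proof.
move=> sn; have p3 := INR_p_ge3; have Q1 := inv_sqr_ge1.
(* The induction carries the current subspace as well. Its codimension plus [2 * Q] stays below the
   tower, hence below [n + 1], so a dimension of at least [2 * Q - 1] is left for the next step. *)
suff [b [m [M [_ _ _ [h0 h1 h2 h3]]]]] : exists (b : nat -> R) m (M : 'M['F_p]_(m, n)),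
  [/\ row_free M, mean_cube A M = b s, INR (n - m) + 2 * Q <= tow (INR p) s (2 * Q) &
   [/\ b 0%N = density A ^ 3,
    forall j, (j <= s)%N -> b j <= density A,
    forall j, (j < s)%N -> 2 * b j - (beta + 2 * delta) <= b j.+1 &
    forall j, (j < s)%N -> forall mu, 0 < mu ->
      mu ^ 2 * (b j - 8 * Rpower (4 * mu) C * (beta + 2 * delta)) <= b j.+1]].
  by exists b.
elim: s sn => [|s IH] sn.
  exists (fun=> density A ^ 3), n, 1%:M%R.
  have E : mean_cube A (1%:M : 'M['F_p]_n)%R = density A ^ 3.
    by rewrite mean_cube1 // RpowE.
  split=> //; first by rewrite row_free_unit unitmx1.
    by rewrite subnn /=; lra.
  split=> // j _; rewrite -E; apply/RleP; exact: mean_cube_le.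
have sn' : tow (INR p) s (2 * Q) <= INR n + 1.
  by apply: Rle_trans sn; apply: tow_le_S; lra.
have [b [m [M [Mfree Mb codim [h0 h1 h2 h3]]]]] := IH sn'.
have mn : (m <= n)%N by rewrite -(eqP Mfree) rank_leq_col.
have mQ : 2 * Q <= INR m + 1.
  move: codim; rewrite minus_INR; last exact/ssrnat.leP; lra.
have [r [M' [M'free h4 h5 h6]]] := mean_cube_step_R Mfree mQ.
exists (fun j => if (j <= s)%N then b j else mean_cube A M'), r, M'; split=> //.
- by rewrite ltnn.
- apply: Rle_trans (_ : _ <= INR (n - m) + Q * Rpower (INR p) (INR (n - m)) + 2 * Q) _.
    by lra.
  by apply: tow_step => //; apply: pos_INR.
split=> // j.
- case: ifP => [js _|_ _]; first exact: h1.
  apply/RleP; exact: mean_cube_le.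
- rewrite ltnS => js; rewrite js; case: ltnP => js'; first exact: h2.
  have -> : j = s by apply/eqP; rewrite eqn_leq js js'.
  by rewrite -Mb.
- rewrite ltnS => js; rewrite js; case: ltnP => js'; first exact: h3.
  have -> : j = s by apply/eqP; rewrite eqn_leq js js'.
  by rewrite -Mb.
Qed.

End Sequence.

(** * Rounding, trimming a set, and the union bound for progressions *)

Lemma nat_floor T : 1 <= T -> exists N : nat, [/\ (1 <= N)%N, INR N <= T & T < INR N + 1].
Proof.
move=> T1; have [h1 h2] := archimed T; pose N := Z.to_nat (up T - 1).
have u1 : Z.lt (Zpos xH) (up T) by apply: lt_IZR; lra.
have NE : INR N = IZR (up T) - 1.
  by rewrite INR_IZR_INZ Z2Nat.id; [rewrite minus_IZR | lia].
exists N; split; [by rewrite /N; lia | lra | lra].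
Qed.

Lemma ceilR_ge x : x <= INR (ceilR x).
Proof.
have [h1 h2] := archimed (- x); rewrite /ceilR; set z := Z.opp _.
have zx : x <= IZR z by rewrite /z opp_IZR minus_IZR; lra.
apply: Rle_trans zx _; rewrite INR_IZR_INZ; apply: IZR_le; lia.
Qed.

Lemma ceilR_lt x : 0 <= x -> INR (ceilR x) < x + 1.
Proof.
move=> x0; have [h1 h2] := archimed (- x); rewrite /ceilR; set z := Z.opp _.
have zx : IZR z < x + 1 by rewrite /z opp_IZR minus_IZR; lra.
have z0 : Z.lt (Zneg xH) z by apply: lt_IZR; rewrite /z opp_IZR minus_IZR; lra.
by rewrite INR_IZR_INZ Z2Nat.id //; lia.
Qed.

Section PointCounts.
Variables (p : nat) (p_pr : prime p) (n : nat).
Implicit Types A : {set 'rV['F_p]_n}.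

Lemma INR_expn_gt0 : 0 < INR (expn p n).
Proof. by apply: lt_0_INR; apply/ssrnat.ltP; rewrite expn_gt0 prime_gt0. Qed.

Lemma ap_density_subset A (B : {set 'rV['F_p]_n}) d :
  A \subset B -> ap_density A d <= ap_density B d.
Proof.
move=> /subsetP AB; apply: Rmult_le_compat_r.
  by apply/Rlt_le/Rinv_0_lt_compat/INR_expn_gt0.
apply/le_INR/ssrnat.leP/subset_leq_card/subsetP => x; rewrite !inE.
by case/and3P=> /AB-> /AB-> /AB->.
Qed.

Lemma card_le_space A : INR #|A| <= INR (expn p n).
Proof.
by apply/le_INR/ssrnat.leP; rewrite -(card_rV_Fp p_pr) max_card.
Qed.

Lemma density_le1 A : density A <= 1.
Proof.
have P0 := INR_expn_gt0; apply: (Rmult_le_reg_r (INR (expn p n))) => //.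
rewrite /density /Rdiv Rmult_assoc Rinv_l ?Rmult_1_r ?Rmult_1_l; last lra.
exact: card_le_space.
Qed.

(** The mean cube is bounded by the density of the set, which must therefore be close to [alpha] and
    not merely at least [alpha]. Trimming is harmless because unpopularity passes to subsets. *)
Lemma density_subset A alpha : 0 < alpha -> alpha <= density A ->
  exists2 B : {set 'rV['F_p]_n}, B \subset A &
    alpha <= density B <= alpha + / INR (expn p n).
Proof.
move=> a0 aA; have P0 := INR_expn_gt0; set P := INR _ in P0 *.
have dE (B : {set 'rV['F_p]_n}) : density B * P = INR #|B|.
  by rewrite /density -/P; field; lra.
have aP : 0 < alpha * P by apply: Rmult_lt_0_compat.
pose c := ceilR (alpha * P).
have c1 : alpha * P <= INR c by exact: ceilR_ge.
have c2 : INR c < alpha * P + 1 by apply: ceilR_lt; lra.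
have cA : (c <= #|A|)%N.
  rewrite -ltnS; apply/ssrnat.ltP/INR_lt; rewrite S_INR -dE; nra.
exists [set x in take c (enum A)].
  by apply/subsetP => x; rewrite inE => /mem_take; rewrite mem_enum.
have cE : #|[set x in take c (enum A)]| = c.
  rewrite cardsE (card_uniqP _) ?take_uniq ?enum_uniq //.
  by rewrite size_takel // -cardE.
rewrite /density -/P cE; split; apply: (Rmult_le_reg_r P) => //.
  by rewrite /Rdiv Rmult_assoc Rinv_l ?Rmult_1_r //; lra.
rewrite /Rdiv Rmult_assoc Rinv_l ?Rmult_1_r; last lra.
by rewrite Rmult_plus_distr_r Rinv_l; lra.
Qed.

Lemma leq_card_ap_set A d : (3 * #|A| <= #|ap_set A d| + 2 * expn p n)%N.
Proof.
pose S e := [set x : 'rV['F_p]_n | (x + e)%R \in A].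
have cS e : #|S e| = #|A|.
  rewrite -(card_preimset A (addIr e)); by apply: eq_card => x; rewrite !inE.
have -> : ap_set A d = A :&: S d :&: S (d *+ 2)%R.
  by apply/setP => x; rewrite !inE andbA.
rewrite -(card_rV_Fp p_pr).
have := cardsUI A (S d); have := cardsUI (A :&: S d) (S (d *+ 2)%R); rewrite !cS.
have := max_card (mem (A :|: S d)); have := max_card (mem (A :&: S d :|: S (d *+ 2)%R)).
move: #|_| #|_| #|_| #|_| #|_| #|_| => *; lia.
Qed.

Lemma ap_density_union_bound A d : 3 * density A - 2 <= ap_density A d.
Proof.
have P0 := INR_expn_gt0; set P := INR _ in P0 *.
suff h : 3 * INR #|A| <= INR #|ap_set A d| + 2 * P.
  rewrite /density /ap_density -/P.
  have -> : 3 * (INR #|A| / P) - 2 = (3 * INR #|A| - 2 * P) / P by field; lra.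
  by apply: Rmult_le_compat_r; [apply/Rlt_le/Rinv_0_lt_compat | lra].
have mulE k m : INR (k * m)%N = INR k * INR m by exact: mult_INR.
have addE k m : INR (k + m)%N = INR k + INR m by exact: plus_INR.
have i2 : INR 2 = 2 by [].
have i3 : INR 3 = 3 by rewrite S_INR i2; lra.
have /ssrnat.leP/le_INR := leq_card_ap_set A d.
by rewrite addE !mulE i2 i3.
Qed.

End PointCounts.

(** * Characteristic two *)

Lemma sum_card_ap_set2 n (A : {set 'rV['F_2]_n}) :
  (\sum_d #|ap_set A d| = #|A| * #|A|)%N.
Proof.
transitivity (\sum_d \sum_x (x \in A) * (x + d \in A)%R)%N.
  apply: eq_bigr => d _; rewrite -sum1_card big_mkcond /=; apply: eq_bigr => x _.
  have -> : (x \in ap_set A d) = (x \in A) && (x + d \in A)%R.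
    rewrite inE -scaler_nat (_ : 2%:R = 0)%R; last exact/val_inj.
    by rewrite scale0r addr0; case: (x \in A); rewrite ?andbT.
  by case: (x \in A); case: (_ \in A).
rewrite exchange_big /= -sum_nat_const [RHS]big_mkcond /=.
apply: eq_bigr => x _; rewrite -big_distrr /=; case: (x \in A) => //=.
rewrite mul1n -sum1_card [RHS]big_mkcond /= [RHS](reindex_inj (@addrI _ x)).
by apply: eq_bigr => d _; case: ifP.
Qed.

Lemma sum_card_le (I : finType) (P : pred I) (f : I -> nat) (y : R) :
  (forall i, P i -> INR (f i) <= y) -> INR (\sum_(i | P i) f i) <= INR #|P| * y.
Proof.
move=> h; rewrite -sum1_card.
rewrite (@big_morph _ _ INR 0 Rplus 0%N addn) //; last by move=> a b; exact: plus_INR.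
rewrite (@big_morph _ _ INR 0 Rplus 0%N addn) //; last by move=> a b; exact: plus_INR.
elim/big_rec2: _ => [|i u v Pi]; first by lra.
have := h i Pi; rewrite /=; lra.
Qed.

Lemma popular_difference2 n (A : {set 'rV['F_2]_n}) (beta : R) :
  (1 <= n)%N ->
  (forall d, nonzero_vec d -> ap_density A d < beta) ->
  INR #|A| ^ 2 - INR #|A| <= (INR (expn 2 n) - 1) * (beta * INR (expn 2 n)).
Proof.
move=> n1 h; have P0 := @INR_expn_gt0 2 isT n.
have A0 : ap_set A 0%R = A.
  by apply/setP => x; rewrite inE mul0rn !addr0 !andbb.
have E : (#|A| + \sum_(d | d != 0%R) #|ap_set A d| = #|A| * #|A|)%N.
  by rewrite -sum_card_ap_set2 [RHS](bigD1 0%R) //= A0.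
have cP : INR #|[pred d : 'rV['F_2]_n | d != 0%R]| = INR (expn 2 n) - 1.
  have c : #|{: 'rV['F_2]_n}| = #|[pred d : 'rV['F_2]_n | d != 0%R]|.+1.
    rewrite (cardD1 (0%R : 'rV['F_2]_n)) add1n; congr S.
    by apply: eq_card => x; rewrite !inE andbT.
  by rewrite -(@card_rV_Fp 2 isT n) c S_INR; lra.
have := @sum_card_le _ (fun d : 'rV['F_2]_n => d != 0%R)
  (fun d => #|ap_set A d|) (beta * INR (expn 2 n)).
have -> : INR #|(fun d : 'rV['F_2]_n => d != 0%R)| = INR (expn 2 n) - 1 by exact: cP.
move/(_ _)=> H.
have {H} : INR (\sum_(d | d != 0%R) #|ap_set A d|) <=
    (INR (expn 2 n) - 1) * (beta * INR (expn 2 n)).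
  apply: H => d d0; have := h d d0; rewrite /ap_density => hd.
  have -> : INR #|ap_set A d| = INR #|ap_set A d| / INR (expn 2 n) * INR (expn 2 n).
    by field; lra.
  by apply: Rmult_le_compat_r; lra.
have := congr1 INR E; rewrite [INR (_ + _)%N]plus_INR [INR (_ * _)%N]mult_INR.
move: (INR #|A|) (INR (\sum_(d | _) _)) => a b; rewrite /= Rmult_1_r; lra.
Qed.

Lemma np_le_char2 alpha eps T :
  0 < alpha <= 1 -> 0 < eps -> 0 < alpha ^ 3 - eps -> 1 / eps <= T ->
  np_le 2 alpha (alpha ^ 3 - eps) T.
Proof.
move=> [a0 a1] e0 b0 eT.
have a31 : alpha ^ 3 <= 1 by rewrite -(pow1 3); apply: pow_incr; lra.
have e1 : 1 <= 1 / eps.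
  by rewrite /Rdiv Rmult_1_l -Rinv_1; apply: Rinv_le_contravar; lra.
have [N [N1 NT TN]] := nat_floor e1.
exists N; split=> //; split; first lra.
move=> n nN A dA; apply: NNPP => H.
have n1 : (1 <= n)%N by apply: leq_trans nN.
have P0 := @INR_expn_gt0 2 isT n.
have {}H : forall d, nonzero_vec d -> ap_density A d < alpha ^ 3 - eps.
  move=> d d0; apply: Rnot_le_lt => hd; apply: H; by exists d.
have {H} := popular_difference2 n1 H.
have aP : INR #|A| = density A * INR (expn 2 n) by rewrite /density; field; lra.
rewrite aP; set a := density A in dA *; have a1' : a <= 1 by exact: density_le1.
have NP : INR N + 1 <= INR (expn 2 n).
  by rewrite -S_INR; apply/le_INR/ssrnat.leP; apply: leq_ltn_trans nN (ltn_expl _ _).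
have eN : 1 <= eps * (2 * INR N).
  have N1' : 1 <= INR N by have := le_INR _ _ (ssrnat.leP N1).
  have : 1 / eps * eps <= (2 * INR N) * eps by apply: Rmult_le_compat_r; lra.
  have -> : 1 / eps * eps = 1 by field; lra.
  lra.
have a3 : alpha ^ 3 <= a ^ 3 by apply: pow_incr; lra.
set P := INR (expn 2 n) in P0 NP *.
set x := alpha ^ 3 in a3 *; move: (INR N) NP eN {TN NT} => M NP eN hh.
have h1 : a ^ 2 * P - a <= (P - 1) * (a ^ 3 - eps).
  apply: (Rmult_le_reg_r P) => //.
  apply: Rle_trans (_ : (P - 1) * ((x - eps) * P) <= _); first by nra.
  have : (P - 1) * (x - eps) <= (P - 1) * (a ^ 3 - eps) by apply: Rmult_le_compat_l; nra.
  nra.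
have h2 : / 2 <= eps * (P - 1) by nra.
have h3 : a * (1 - a) <= / 4 by have := Rle_0_sqr (a - / 2); rewrite /Rsqr; nra.
have h4 : 0 <= a ^ 2 * (1 - a) * (P - 1).
  by apply: Rmult_le_pos; [apply: Rmult_le_pos; [nra|lra] | nra].
nra.
Qed.

(** * From sequences of mean cubes to bounds in the three ranges *)

(** Separates the geometry from the choice of parameters: each range only has to pick [delta] and
    [s] so that no real sequence obeys both increments for [s] steps and stays below [a]. *)
Lemma np_le_of_sequences p C alpha beta delta s T :
  prime p -> (2 < p)%N -> supersat p C -> 0 <= C -> 0 < alpha -> 0 <= beta ->
  0 < delta < 1 -> tow (INR p) s (2 * / delta ^ 2) <= T ->
  (forall (b : nat -> R) a, alpha <= a <= alpha + delta -> b 0%N = a ^ 3 ->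
    (forall j, (j <= s)%N -> b j <= a) ->
    (forall j, (j < s)%N -> 2 * b j - (beta + 2 * delta) <= b j.+1) ->
    (forall j, (j < s)%N -> forall mu, 0 < mu ->
      mu ^ 2 * (b j - 8 * Rpower (4 * mu) C * (beta + 2 * delta)) <= b j.+1) ->
    False) ->
  np_le p alpha beta T.
Proof.
move=> p_pr p2 sup C0 a0 b0 d01 sT contra.
have Q1 := inv_sqr_ge1 d01; have p3 := INR_p_ge3 p2.
have tQ : 2 * / delta ^ 2 <= tow (INR p) s (2 * / delta ^ 2).
  by apply: (@tow_le_height _ 0 s) => //; lra.
have T1 : 1 <= T by lra.
have [N [N1 NT TN]] := nat_floor T1.
exists N; split=> //; split=> // n nN A dA; apply: NNPP => H.
have nN' : INR N <= INR n by apply/le_INR/ssrnat.leP.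
have P0 := @INR_expn_gt0 p p_pr n.
have [B BA [aB Ba]] := density_subset p_pr a0 dA.
have Pd : / INR (expn p n) <= delta by apply: inv_pow_le_delta => //; lra.
have unp d : nonzero_vec d -> ap_density B d < beta.
  move=> d0; apply: Rle_lt_trans (ap_density_subset p_pr d BA) _.
  by apply: Rnot_le_lt => hd; apply: H; exists d.
have sn : tow (INR p) s (2 * / delta ^ 2) <= INR n + 1 by lra.
have [b [h0 h1 h2 h3]] := increment_sequence p_pr p2 sup C0 b0 d01 unp sn.
by apply: (contra b (density B)) => //; lra.
Qed.

Lemma ln2_bounds : / 2 < ln 2 <= 1.
Proof.
split; first exact: ln_lt_2.
rewrite -(ln_exp 1); apply: ln_le; first lra.
by have := exp_ineq1_le 1; lra.
Qed.

Lemma Rpower2_log2 x : 0 < x -> Rpower 2 (log2 x) = x.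
Proof.
move=> x0; rewrite /Rpower /log2; have := ln2_bounds => h.
have -> : ln x / ln 2 * ln 2 = ln x by field; lra.
exact: exp_ln.
Qed.

Lemma log2_le x y : 0 < x -> x <= y -> log2 x <= log2 y.
Proof.
move=> x0 xy; apply: Rmult_le_compat_r; last exact: ln_le.
by have := ln2_bounds => h; apply/Rlt_le/Rinv_0_lt_compat; lra.
Qed.

Lemma log2_mult x y : 0 < x -> 0 < y -> log2 (x * y) = log2 x + log2 y.
Proof. by move=> x0 y0; rewrite /log2 ln_mult // /Rdiv; ring. Qed.

Lemma log2_div x y : 0 < x -> 0 < y -> log2 (x / y) = log2 x - log2 y.
Proof.
move=> x0 y0; rewrite /log2 /Rdiv ln_mult ?ln_Rinv //; first by ring.
exact: Rinv_0_lt_compat.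
Qed.

Lemma log2_Rpower c : log2 (Rpower 2 c) = c.
Proof.
by have := ln2_bounds => h; rewrite /log2 /Rpower ln_exp; field; lra.
Qed.

Lemma log2_2 : log2 2 = 1.
Proof. by have := ln2_bounds => h; rewrite /log2; field; lra. Qed.

Lemma log2_cube x : 0 < x -> log2 (x ^ 3) = 3 * log2 x.
Proof.
move=> x0; have x2 : 0 < x * x by apply: Rmult_lt_0_compat.
have -> : x ^ 3 = x * x * x by ring.
by rewrite !log2_mult //; ring.
Qed.

Lemma ln_le_log2 x : 1 <= x -> ln x <= log2 x.
Proof.
move=> x1; have h := ln2_bounds.
have l0 : 0 <= ln x by rewrite -ln_1; apply: ln_le; lra.
have e : log2 x * ln 2 = ln x by rewrite /log2; field; lra.
have g0 : 0 <= log2 x.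
  by apply: Rmult_le_pos => //; apply/Rlt_le/Rinv_0_lt_compat; lra.
nra.
Qed.

Lemma pow2_ge k x : 0 < x -> log2 x <= INR k -> x <= 2 ^ k.
Proof.
move=> x0 xk; rewrite -{1}(Rpower2_log2 x0) -Rpower_pow; last lra.
by apply: Rle_Rpower; lra.
Qed.

(** Covers [(alpha - alpha^3) / eps <= 1], where the logarithm in (1) is of no use; by the union
    bound every difference is then popular. Positivity forces [2 alpha^2 >= 1], and the claim
    reduces to [(1 - alpha) (alpha^2 + alpha - 1) >= 0]. *)
Lemma cube_sub_le alpha eps : 0 < alpha <= 1 -> 0 < alpha ^ 3 - eps ->
  alpha - alpha ^ 3 <= eps -> alpha ^ 3 - eps <= 3 * alpha - 2.
Proof.
move=> [a0 a1] b0 ae.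
have h : 1 <= 2 * alpha ^ 2 by nra.
have h2 : 1 <= alpha + alpha ^ 2 by nra.
have : 0 <= (1 - alpha) * (alpha + alpha ^ 2 - 1) by nra.
nra.
Qed.

Lemma np_le_trivial p alpha beta T : prime p -> 1 <= T -> beta <= 3 * alpha - 2 ->
  np_le p alpha beta T.
Proof.
move=> p_pr T1 ab; exists 1%N; split=> //; split; first exact: T1.
move=> n n1 A dA; exists (const_mx 1%R); split.
  apply/eqP => /rowP /(_ (Ordinal n1)); rewrite !mxE => /eqP; by rewrite oner_eq0.
by have := ap_density_union_bound p_pr A (const_mx 1%R); lra.
Qed.

Lemma Tow_ge a h r : 2 <= a -> 0 <= r -> r <= Tow a h r.
Proof. by move=> a2 r0; apply: (@tow_le_height a 0). Qed.

Lemma tow_two_div_sqr p D r c : 3 <= p -> 1 <= r -> 2 * D ^ 2 <= 3 ^ c * 27 ->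
  2 * (D * r) ^ 2 <= tow p (c + 2) r.
Proof.
move=> p3 r1 Dc; apply: Rle_trans (tow_ge_sqr c p3 r1).
have r2 : 0 <= r ^ 2 by apply: pow2_ge_0.
by rewrite Rpow_mult_distr; nra.
Qed.

(** With [delta = eps / 4] the initial excess is at least [eps / 2]; multiplied by [4 t] it becomes
    [2 (alpha - alpha^3)], too much for a density at most [alpha + eps / 4] once [t > 1]. Of the 5
    extra levels, two yield the factor 4 and three absorb the bottom [2 (4 / eps)^2]. *)
Lemma np_le_doubling p C alpha eps : prime p -> (2 < p)%N -> supersat p C ->
  0 <= C -> 0 < alpha <= 1 -> 0 < eps -> 0 < alpha ^ 3 - eps ->
  np_le p alpha (alpha ^ 3 - eps)
    (Tow (INR p) (log2 ((alpha - alpha ^ 3) / eps) + 5) (1 / eps)).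
Proof.
move=> p_pr p2 sup C0 [a0 a1] e0 b0; have p3 := INR_p_ge3 p2.
have a31 : alpha ^ 3 <= 1 by rewrite -(pow1 3); apply: pow_incr; lra.
set r := 1 / eps; have re : r * eps = 1 by rewrite /r; field; lra.
have r1 : 1 <= r by nra.
set t := (alpha - alpha ^ 3) / eps.
have te : t * eps = alpha - alpha ^ 3 by rewrite /t; field; lra.
set h := ceilR (log2 t + 5).
case: (Rle_lt_dec t 1) => [t1|t1].
  apply: np_le_trivial => //; last by apply: cube_sub_le => //; nra.
  by apply: (Rle_trans _ _ _ r1); apply: Tow_ge; lra.
have t0 : 0 < t by lra.
have lt0 : 0 <= log2 t.
  by have <- : log2 1 = 0; [rewrite /log2 ln_1 /Rdiv Rmult_0_l | apply: log2_le; lra].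
have hl : log2 t + 5 <= INR h by exact: ceilR_ge.
have h5 : (5 <= h)%N.
  by apply/ssrnat.leP/INR_le; rewrite [INR 5]/=; lra.
have sE : INR (h - 3) = INR h - 3.
  rewrite minus_INR; last by apply/ssrnat.leP; lia.
  by rewrite [INR 3]/=; lra.
have st : 4 * t <= 2 ^ (h - 3).
  apply: pow2_ge; first lra.
  rewrite log2_mult; [|lra|lra].
  have -> : log2 4 = 2.
    have -> : 4 = 2 * 2 by ring.
    rewrite log2_mult ?log2_2; try lra.
  by rewrite sE; lra.
have QE : 2 * / (eps / 4) ^ 2 = 2 * (4 * r) ^ 2 by rewrite /r; field; lra.
apply: (@np_le_of_sequences p C alpha _ (eps / 4) (h - 3)) => //; [lra|lra| |].
  rewrite QE /Tow -/h (_ : h = (h - 3) + (1 + 2))%N; last by lia.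
  rewrite addnK tow_addn; apply: tow_le_top; first lra.
  by apply: tow_two_div_sqr => //; lra.
move=> b a [aa ad] bE b1 b2 _.
have a3 : alpha ^ 3 <= a ^ 3 by apply: pow_incr; lra.
have := doubling_sequence b2; have := b1 _ (leqnn _).
rewrite bE; move: (2 ^ (h - 3)) st (b (h - 3)%N) => X st y.
move: (alpha ^ 3) (a ^ 3) te b0 a31 a3 => u v te b0 a31 a3 ya.
have : X * (eps / 2) <= X * (v - (u - eps + 2 * (eps / 4))).
  by apply: Rmult_le_compat_l; nra.
nra.
Qed.

(** Since [b <= 2 alpha], the exponent can never exceed [log (2 alpha / beta)], but [j] steps
    multiply [u] by at least [exp (j / (2 C))]. *)
Lemma supersat_contradiction (b : nat -> R) alpha beta B C u a j0 j :
  0 < alpha -> 0 < beta -> 1 <= C -> B <= 2 * beta -> 5 * C + 10 <= u ->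
  (forall i, (j0 <= i < j0 + j)%N ->
     forall mu, 0 < mu -> mu ^ 2 * (b i - 8 * Rpower (4 * mu) C * B) <= b i.+1) ->
  beta * Rpower 2 u <= b j0 -> b (j0 + j)%N <= a -> a <= 2 * alpha ->
  0 < log2 (alpha / beta) + 1 ->
  ln ((log2 (alpha / beta) + 1) / u) < INR j / (2 * C) -> False.
Proof.
move=> a0 b0 C1 B2 u1 growth ub ba a2 U0 lnj; set U := log2 _ in U0 lnj.
have h1 := supersat_sequence b0 C1 B2 u1 growth ub.
have UE : beta * Rpower 2 (U + 1) = 2 * alpha.
  rewrite Rpower_plus Rpower_1; last lra.
  rewrite Rpower2_log2; last by apply: Rdiv_lt_0_compat.
  by field; lra.
have le : Rpower 2 (u * (1 + / C) ^ j) <= Rpower 2 (U + 1).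
  by apply: (Rmult_le_reg_l beta) => //; lra.
have {}le : u * (1 + / C) ^ j <= U + 1.
  by rewrite -(log2_Rpower (u * _)) -(log2_Rpower (U + 1)); apply: log2_le; [exact: exp_pos|].
have q0 : 0 < (U + 1) / u by apply: Rdiv_lt_0_compat; lra.
have := exp_increasing _ _ lnj; rewrite exp_ln // => h2.
have := exp_le_pow j C1 => h3.
have : (U + 1) / u * u = U + 1 by field; lra.
nra.
Qed.

(** Keeps the height in (3) above a constant, so that it can absorb rounding and the lower levels.
    It rests on [ln (1 + 1 / C) >= 1 / (C + 1)]. *)
Lemma log2_ratio_ge C u U : 1 <= C -> 0 < u -> u * (1 + / C) <= U ->
  1 <= 2 * C * log2 (U / u).
Proof.
move=> C1 u0 uU; have iC : 0 < / C by apply: Rinv_0_lt_compat; lra.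
have r1 : 1 + / C <= U / u.
  by apply: (Rmult_le_reg_r u) => //; rewrite /Rdiv Rmult_assoc Rinv_l; lra.
have l1 : ln (U / u) <= log2 (U / u) by apply: ln_le_log2; lra.
have l2 : ln (1 + / C) <= ln (U / u) by apply: ln_le; lra.
have l3 : / (C + 1) <= ln (1 + / C).
  have e0 := exp_ineq1_le (- ln (1 + / C)).
  rewrite exp_Ropp exp_ln in e0; last lra.
  have -> : / (C + 1) = 1 - / (1 + / C) by field; lra.
  lra.
have l4 : / (2 * C) <= / (C + 1) by apply: Rinv_le_contravar; lra.
have : 2 * C * / (2 * C) = 1 by field; lra.
nra.
Qed.

Lemma np_le_small_beta p C c2 alpha eps : prime p -> (2 < p)%N -> supersat p C ->
  1 <= C -> C <= c2 * log2 (INR p) -> 0 < alpha <= 1 -> 0 < eps ->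
  rpow alpha C / 2 <= alpha ^ 3 - eps ->
  alpha ^ 3 - eps <= Rpower 2 (-8 - 8 * C) * alpha ^ 3 ->
  np_le p alpha (alpha ^ 3 - eps)
    (Tow (INR p) (62 * c2 * log2 (INR p) *
       log2 (log2 (alpha / (alpha ^ 3 - eps)) / log2 (alpha ^ 3 / (alpha ^ 3 - eps))))
       (1 / (alpha ^ 3 - eps))).
Proof.
move=> p_pr p2 sup C1 Cc2 [a0 a1] e0; have p3 := INR_p_ge3 p2.
set beta := alpha ^ 3 - eps => lo hi.
have a30 : 0 < alpha ^ 3 by apply: pow_lt.
have a3a : alpha ^ 3 <= alpha.
  have := pow_incr alpha 1 2; rewrite pow1 => /(_ (conj (Rlt_le _ _ a0) a1)).
  by rewrite /=; nra.
move: lo; rewrite /rpow; case: Rle_dec => a0n /= lo; first lra.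
have ac0 : 0 < Rpower alpha C by exact: exp_pos.
have b0 : 0 < beta by lra.
pose la := log2 alpha; pose lb := log2 beta.
have UE : log2 (alpha / beta) = la - lb by rewrite log2_div.
have uE : log2 (alpha ^ 3 / beta) = 3 * la - lb by rewrite log2_div // log2_cube.
rewrite UE uE.
have la0 : la <= 0.
  by have <- : log2 1 = 0; [rewrite /log2 ln_1 /Rdiv Rmult_0_l | apply: log2_le].
have lb_lo : C * la - 1 <= lb.
  have -> : C * la - 1 = log2 (Rpower alpha C / 2).
    by rewrite log2_div ?log2_2; [rewrite /la /log2 /Rpower ln_exp; lra | done | lra].
  by apply: log2_le; [lra | exact: lo].
have lb_hi : lb <= (-8 - 8 * C) + 3 * la.
  have -> : (-8 - 8 * C) + 3 * la = log2 (Rpower 2 (-8 - 8 * C) * alpha ^ 3).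
    by rewrite log2_mult ?log2_Rpower ?log2_cube //; exact: exp_pos.
  exact: log2_le.
set u := 3 * la - lb; set U := la - lb.
have u8 : 8 * C + 8 <= u by rewrite /u; lra.
have uU : u <= U by rewrite /u /U; lra.
have Cla : 7 <= C * - la by rewrite /u in u8; nra.
(* The hypothesis [beta >= alpha^C / 2] enters here: it gives [u <= (C - 3) (- la) + 1], which is at
   most [C] times the gap [U - u = - 2 la]. *)
have ruU : u * (1 + / C) <= U.
  have : u * / C <= - 2 * la.
    have -> : - 2 * la = (- 2 * la * C) * / C by field; lra.
    apply: Rmult_le_compat_r; first by apply/Rlt_le/Rinv_0_lt_compat; lra.
    by rewrite /u; nra.
  by rewrite /u /U; lra.
have l1 := @log2_ratio_ge C u U C1 (_ : 0 < u) ruU.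
have {}l1 : 1 <= 2 * C * log2 (U / u) by apply: l1; lra.
set l := log2 (U / u) in l1 *; set H := _ * l; set h := ceilR H.
have l0 : 0 < l by nra.
have Hl : 62 * C * l <= H.
  rewrite /H; apply: Rmult_le_compat_r; first lra.
  by rewrite Rmult_assoc; apply: Rmult_le_compat_l; lra.
have hH : H <= INR h by exact: ceilR_ge.
have h3 : (3 <= h)%N.
  by apply/ssrnat.leP/INR_le; rewrite [INR 3]/=; nra.
have sE : INR (h - 3) = INR h - 3.
  by rewrite minus_INR; [rewrite [INR 3]/=; lra | apply/ssrnat.leP].
set r := 1 / beta; have re : r * beta = 1 by rewrite /r; field; lra.
have P1 : Rpower 2 (-8 - 8 * C) <= / 4.
  have -> : / 4 = Rpower 2 (Ropp (INR 2)).
    by rewrite Rpower_Ropp Rpower_pow; [congr (/ _); ring | lra].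
  by apply: Rle_Rpower; rewrite ?[INR 2]/=; lra.
have a31 : alpha ^ 3 <= 1 by lra.
have b4 : beta <= / 4 by nra.
have r1 : 1 <= r by nra.
have QE : 2 * / (beta / 4) ^ 2 = 2 * (4 * r) ^ 2 by rewrite /r; field; lra.
apply: (@np_le_of_sequences p C alpha _ (beta / 4) (h - 3)) => //; [lra|lra|lra| |].
  rewrite QE /Tow -/h {2}(_ : h = (h - 3) + (1 + 2))%N; last by lia.
  rewrite tow_addn; apply: tow_le_top; first lra.
  by apply: tow_two_div_sqr => //; lra.
move=> b a [aa ad] bE b1 _ b3.
have a3 : alpha ^ 3 <= a ^ 3 by apply: pow_incr; lra.
apply: (@supersat_contradiction b alpha beta (beta + 2 * (beta / 4)) C u a 0 (h - 3)) => //.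
- lra.
- lra.
- rewrite bE (_ : u = log2 (alpha ^ 3 / beta)) // Rpower2_log2; last exact: Rdiv_lt_0_compat.
  by have -> : beta * (alpha ^ 3 / beta) = alpha ^ 3 by field; lra.
- exact: b1.
- by nra.
- by rewrite UE -/U; lra.
rewrite UE -/U sE.
have -> : (U + 1) / u = (U / u) * (1 + / U) by field; lra.
have iU : 0 < / U by apply: Rinv_0_lt_compat; lra.
have q0 : 1 <= U / u.
  by apply: (Rmult_le_reg_r u); first lra; rewrite /Rdiv Rmult_assoc Rinv_l; lra.
rewrite ln_mult; [|lra|lra].
have lU : ln (1 + / U) <= / U.
  rewrite -[X in _ <= X]ln_exp; apply: ln_le; first lra; exact: exp_ineq1_le.
have := ln_le_log2 q0; rewrite -/l => lr.
have U8 : / U <= / (8 * C) by apply: Rinv_le_contravar; lra.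
have i8 : 2 * C * / (8 * C) = / 4 by field; lra.
apply: (Rmult_lt_reg_r (2 * C)); first lra.
rewrite (_ : (INR h - 3) / (2 * C) * (2 * C) = INR h - 3); last by field; lra.
have : (ln (U / u) + ln (1 + / U)) * (2 * C) <= (l + / (8 * C)) * (2 * C).
  by apply: Rmult_le_compat_r; lra.
nra.
Qed.

Lemma np_le_medium_beta p C c2 alpha eps : prime p -> (2 < p)%N -> supersat p C ->
  1 <= C -> C <= c2 * log2 (INR p) -> 0 < alpha <= 1 -> 0 < eps ->
  0 < alpha ^ 3 - eps ->
  Rpower 2 (-8 - 8 * C) * alpha ^ 3 < alpha ^ 3 - eps <=
    Rpower 2 (-8 - 8 * C) * alpha ->
  np_le p alpha (alpha ^ 3 - eps)
    (Tow (INR p) (log2 ((alpha ^ 3 - eps) / eps) +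
       62 * c2 * log2 (INR p) *
       log2 (ln (alpha / (alpha ^ 3 - eps)) / ln (INR p)))
       (1 / eps)).
Proof.
move=> p_pr p2 sup C1 Cc2 [a0 a1] e0; have p3 := INR_p_ge3 p2.
set beta := alpha ^ 3 - eps => b0 [lo hi].
have a30 : 0 < alpha ^ 3 by apply: pow_lt.
have a31 : alpha ^ 3 <= 1 by rewrite -(pow1 3); apply: pow_incr; lra.
have lgp := supersat_exponent_ge p_pr p2 C1 sup.
set lg := log2 (INR p) in Cc2 lgp *.
have b2 := ln2_bounds.
have lnp : lg * ln 2 = ln (INR p) by rewrite /lg /log2; field; lra.
have lnp1 := ln_ge_1 p3.
have lg0 : 0 < lg by nra.
set U := log2 (alpha / beta).
have lnU : U * ln 2 = ln (alpha / beta) by rewrite /U /log2; field; lra.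
set W := _ / ln (INR p).
have WE : W = U / lg by rewrite /W -lnU -lnp; field; lra.
have U8 : 8 * C + 8 <= U.
  have -> : 8 * C + 8 = - log2 (Rpower 2 (-8 - 8 * C)) by rewrite log2_Rpower; ring.
  have := log2_le b0 hi; rewrite log2_mult //; last exact: exp_pos.
  by rewrite /U log2_div //; lra.
have UWl : U = W * lg by rewrite WE; field; lra.
have W2 : 2 <= W by nra.
set w := log2 W.
have w1 : 1 <= w by rewrite -log2_2; apply: log2_le; lra.
have lnw : ln W <= w by apply: ln_le_log2; lra.
have lnW0 : 0 <= ln W by rewrite -ln_1; apply: ln_le; lra.
set lbe := log2 (beta / eps).
have be0 : 0 < beta / eps by apply: Rdiv_lt_0_compat.
(* [lbe] may be negative; this keeps the argument of [ceilR] in [j1] nonnegative. *)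
have lbe_lo : -8 - 8 * C <= lbe.
  rewrite -(log2_Rpower (-8 - 8 * C)); apply: log2_le; first exact: exp_pos.
  apply: (Rmult_le_reg_r eps) => //.
  have -> : beta / eps * eps = beta by field; lra.
  have P0 : 0 < Rpower 2 (-8 - 8 * C) by exact: exp_pos.
  have : Rpower 2 (-8 - 8 * C) * eps <= Rpower 2 (-8 - 8 * C) * alpha ^ 3.
    by apply: Rmult_le_compat_l; rewrite /beta in b0; lra.
  lra.
set H := lbe + _; set h := ceilR H.
have hH : H <= INR h by exact: ceilR_ge.
have HE : lbe + 62 * C * w <= H.
  rewrite /H; apply: Rplus_le_compat_l; apply: Rmult_le_compat_r; first lra.
  by rewrite Rmult_assoc; apply: Rmult_le_compat_l; lra.
(* [j1] doubling steps bring the mean cube to [2 ^ (8 C + 8) * beta], after which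
   [j2] supersaturation steps would bring it above [2 * alpha]; [c + 2] levels of
   the tower pay for the constants. *)
pose j1 := ceilR (8 * C + 9 + lbe); pose j2 := ceilR (2 * C * ln W + 1).
pose c := ceilR (21 + 16 * C).
have j1a : 8 * C + 9 + lbe <= INR j1 by exact: ceilR_ge.
have j1b : INR j1 < 8 * C + 9 + lbe + 1 by apply: ceilR_lt; lra.
have ClnW : 0 <= C * ln W by apply: Rmult_le_pos; lra.
have j2a : 2 * C * ln W + 1 <= INR j2 by exact: ceilR_ge.
have j2b : INR j2 < 2 * C * ln W + 1 + 1 by apply: ceilR_lt; lra.
have ca : 21 + 16 * C <= INR c by exact: ceilR_ge.
have cb : INR c < 21 + 16 * C + 1 by apply: ceilR_lt; lra.
(* Origin of 62: the left side is at most [lbe + 2 C ln W + 24 C + 36], and [ln W <= w], [1 <= w],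
   [1 <= C] turn this into [lbe + (2 + 24 + 36) C w]. *)
have ht : (j1 + j2 + (c + 2) <= h)%N.
  apply/ssrnat.leP/INR_le; apply: (Rle_trans _ _ _ _ hH).
  have addE k l : INR (k + l)%N = INR k + INR l by exact: plus_INR.
  have i2 : INR 2 = 2 by [].
  rewrite !addE i2.
  have : C * ln W <= C * w by apply: Rmult_le_compat_l; lra.
  have : C <= C * w by nra.
  lra.
set r := 1 / eps; have re : r * eps = 1 by rewrite /r; field; lra.
have r1 : 1 <= r by rewrite /beta in b0; nra.
(* The error must be small against [eps] for the initial excess to survive, and against [beta] for
   [B <= 2 beta]. As [eps < alpha^3 < P * beta], taking the minimum costs at most the factor [P]. *)
pose e := Rmin eps beta.
have ee : e <= eps by exact: Rmin_l.
have eb : e <= beta by exact: Rmin_r.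
pose P := Rpower 2 (8 + 8 * C).
have P1 : 1 <= P.
  rewrite -(Rpower_O 2); last lra.
  by apply: Rle_Rpower; lra.
have ePP : eps <= P * e.
  rewrite /e /Rmin; case: Rle_dec => _; first nra.
  have : P * (Rpower 2 (-8 - 8 * C) * alpha ^ 3) <= P * beta.
    by apply: Rmult_le_compat_l; lra.
  have -> : P * (Rpower 2 (-8 - 8 * C) * alpha ^ 3) = alpha ^ 3.
    rewrite -Rmult_assoc -Rpower_plus.
    have -> : 8 + 8 * C + (-8 - 8 * C) = 0 by ring.
    by rewrite Rpower_O; lra.
  by rewrite /beta in b0; lra.
have ep : 0 < e by nra.
have QE : 2 * / (e / 4) ^ 2 <= 2 * ((4 * P) * r) ^ 2.
  have -> : 2 * / (e / 4) ^ 2 = 2 * (4 * (1 / e)) ^ 2 by field; lra.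
  have i0 : 0 < 1 / e by apply: Rdiv_lt_0_compat; lra.
  have : 1 / e <= P * r.
    apply: (Rmult_le_reg_r e) => //; have -> : 1 / e * e = 1 by field; lra.
    nra.
  move=> le; apply: Rmult_le_compat_l; first lra.
  by apply: pow_incr; lra.
(* The left side is [2^(21 + 16 C)], whence the choice of [c]. *)
have Dc : 2 * (4 * P) ^ 2 <= 3 ^ c * 27.
  have PP : P * P = Rpower 2 (16 + 16 * C).
    by rewrite -Rpower_plus; congr Rpower; ring.
  have c2c : Rpower 2 (INR 5 + (16 + 16 * C)) <= 2 ^ c.
    rewrite -Rpower_pow; last lra.
    by apply: Rle_Rpower; rewrite ?[INR 5]/=; lra.
  rewrite Rpower_plus Rpower_pow -?PP in c2c; last lra.
  have c23 : 2 ^ c <= 3 ^ c by apply: pow_incr; lra.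
  have := pow_lt 2 c Rlt_0_2; rewrite [2 ^ 5]/= in c2c; nra.
have be1 : beta <= 1 by rewrite /beta; lra.
apply: (@np_le_of_sequences p C alpha _ (e / 4) (j1 + j2)) => //; [lra|lra|lra| |].
  apply: (@Rle_trans _ (tow (INR p) (j1 + j2) (tow (INR p) (c + 2) r))).
    apply: tow_le_top; first lra.
    by apply: (Rle_trans _ _ _ QE); apply: tow_two_div_sqr.
  by rewrite -tow_addn /Tow -/h; apply: tow_le_height => //; lra.
move=> b a [aa ad] bE b1 bd b3.
have a3 : alpha ^ 3 <= a ^ 3 by apply: pow_incr; lra.
(* Here the base [p] of the logarithm is reached: [W = U / log p] with [log p <= 3 (C - 1)], well
   below [8 C + 8]. *)
have lnj : ln ((U + 1) / (8 * C + 8)) <= ln W.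
  apply: ln_le; first by apply: Rdiv_lt_0_compat; lra.
  apply: (Rmult_le_reg_r (8 * C + 8)); first lra.
  have -> : (U + 1) / (8 * C + 8) * (8 * C + 8) = U + 1 by field; lra.
  nra.
have bu : beta * Rpower 2 (8 * C + 8) <= b j1.
  have dbl := @doubling_sequence b (beta + 2 * (e / 4)) j1 (fun i ij => bd i (ltn_addr _ ij)).
  have X0 : Rpower 2 (8 * C + 9 + lbe) <= 2 ^ j1.
    by rewrite -Rpower_pow; [apply: Rle_Rpower; lra | lra].
  rewrite bE in dbl.
  have e2 : eps / 2 <= a ^ 3 - (beta + 2 * (e / 4)) by rewrite /beta; lra.
  have P2 : 0 < 2 ^ j1 by apply: pow_lt; lra.
  have : Rpower 2 (8 * C + 9 + lbe) * (eps / 2) = beta * Rpower 2 (8 * C + 8).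
    have -> : 8 * C + 9 + lbe = (8 * C + 8) + 1 + lbe by ring.
    rewrite !Rpower_plus Rpower_1 ?Rpower2_log2 //; last lra.
    by field; lra.
  have : Rpower 2 (8 * C + 9 + lbe) * (eps / 2) <= 2 ^ j1 * (a ^ 3 - (beta + 2 * (e / 4))).
    by apply: Rmult_le_compat; [exact/Rlt_le/exp_pos | lra | lra | lra].
  lra.
apply: (@supersat_contradiction b alpha beta (beta + 2 * (e / 4)) C (8 * C + 8) a j1 j2) => //.
- lra.
- lra.
- by move=> i /andP[_ ij]; exact: b3.
- exact: b1.
- have : beta <= alpha.
    apply: (Rle_trans _ _ _ hi); rewrite -[X in _ <= X]Rmult_1_l.
    apply: Rmult_le_compat_r; first lra.
    by rewrite -(Rpower_O 2); [apply: Rle_Rpower; lra | lra].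
  lra.
- by rewrite -/U; lra.
rewrite -/U; apply: (Rle_lt_trans _ _ _ lnj).
apply: (Rmult_lt_reg_r (2 * C)); first lra.
have -> : INR j2 / (2 * C) * (2 * C) = INR j2 by field; lra.
lra.
Qed.

Theorem theorem6 (C : nat -> R)
  (HC1 : forall p : nat, prime p -> 1 <= C p)
  (HCtheta : exists c1 c2 : R, 0 < c1 /\
     forall p : nat, prime p -> c1 * log2 (INR p) <= C p <= c2 * log2 (INR p))
  (HCsup : forall p : nat, prime p -> supersat p (C p)) :
  exists K : R, forall (p : nat) (alpha eps : R),
    prime p -> 0 < alpha <= 1 -> 0 < eps ->
    let beta := alpha ^ 3 - eps in
    rpow alpha (C p) / 2 <= beta ->
    (* (1) *)
    np_le p alpha beta
      (Tow (INR p) (log2 ((alpha - alpha ^ 3) / eps) + 5) (1 / eps)) /\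
    (* (2) *)
    (Rpower 2 (-8 - 8 * C p) * alpha ^ 3 < beta <= Rpower 2 (-8 - 8 * C p) * alpha ->
     np_le p alpha beta
       (Tow (INR p)
          (log2 (beta / eps)
           + K * log2 (INR p) * log2 (ln (alpha / beta) / ln (INR p)))
          (1 / eps))) /\
    (* (3) *)
    (beta <= Rpower 2 (-8 - 8 * C p) * alpha ^ 3 ->
     np_le p alpha beta
       (Tow (INR p)
          (K * log2 (INR p) * log2 (log2 (alpha / beta) / log2 (alpha ^ 3 / beta)))
          (1 / beta))).
Proof.
have [c1 [c2 [_ Cc]]] := HCtheta; exists (62 * c2) => p alpha eps p_pr a01 e0 beta lo.
have C1 := HC1 p p_pr; have sup := HCsup p p_pr; have [_ Cc2] := Cc p p_pr.
have b0 : 0 < beta.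
  apply: Rlt_le_trans lo; move: a01; rewrite /rpow; case: Rle_dec => a0n /= a01; first lra.
  by have := exp_pos (C p * ln alpha); rewrite /Rpower; lra.
have a31 : alpha ^ 3 <= 1 by rewrite -(pow1 3); apply: pow_incr; lra.
have r0 : 0 <= 1 / eps by apply/Rlt_le/Rdiv_lt_0_compat; lra.
case: (ltnP 2 p) => p2.
  split; first by apply: (np_le_doubling p_pr p2 sup) => //; lra.
  split=> hyp; first exact: (np_le_medium_beta p_pr p2 sup).
  exact: (np_le_small_beta p_pr p2 sup).
have {p2} pE : p = 2%N by have := prime_gt1 p_pr; lia.
rewrite pE in C1 *; have INR2 : INR 2 = 2 by [].
split; first by apply: np_le_char2 => //; apply: Tow_ge; lra.
split=> hyp; first by apply: np_le_char2 => //; apply: Tow_ge; lra.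
apply: np_le_char2 => //.
(* In (3) the tower starts from [1 / beta] while the pair count needs [1 / eps]; here [beta] is at
   most half of [alpha^3]. *)
have be : beta <= eps.
  have P2 : Rpower 2 (-8 - 8 * C 2%N) <= / 2.
    rewrite -[X in / X](Rpower_1 2) -?Rpower_Ropp; last lra.
    by apply: Rle_Rpower; lra.
  have a30 : 0 < alpha ^ 3 by apply: pow_lt; lra.
  have : Rpower 2 (-8 - 8 * C 2%N) * alpha ^ 3 <= / 2 * alpha ^ 3.
    by apply: Rmult_le_compat_r; lra.
  have : beta = alpha ^ 3 - eps by [].
  lra.
apply: (Rle_trans _ (1 / beta)); last first.
  by apply: Tow_ge; [lra | apply/Rlt_le/Rdiv_lt_0_compat; lra].
by rewrite /Rdiv !Rmult_1_l; apply: Rinv_le_contravar.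
Qed.
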